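(* Let $d\ge 1$ be an integer and let $H$ be the random Schrödinger operator of the Anderson model on $\ell^2(\mathbb{Z}^d)$, with realizations $(H^{(\omega)}\varphi)(x)=\sum_{y\in\mathbb{Z}^d:\,|x-y|=1}\varphi(y)+\omega_x\varphi(x)$, where $\{\omega_x\}_{x\in\mathbb{Z}^d}$ are independent, identically distributed real-valued random variables. Assume that the distribution of $\omega_0$ is absolutely continuous with respect to Lebesgue measure and that its Lebesgue density $\rho$ satisfies $$\rho_{\min}:=\operatorname*{ess\,inf}_{w\in[W_-,W_+]}\rho(w)>0$$ for some $-\infty<W_-<W_+<\infty$. Assume further that the integrated density of states $E\mapsto N(E)$ of $H$ is an absolutely continuous function, with Lebesgue derivative (density of states) $n(E)=\mathrm{d}N(E)/\mathrm{d}E$. Then for every sufficiently small $\delta>0$ there exists a constant $C_\delta>0$ such that $$n(E)\ge C_\delta>0$$ for Lebesgue-almost all $E\in[-2d+W_-+\delta,\;2d+W_+-\delta]$.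
   Context: The random variables $\{\omega_x\}_{x\in\mathbb{Z}^d}$ live on a probability space $(\Omega,\mathbb{P})$. Write $H^{(\omega)}=\mathcal{L}+V^{(\omega)}$, where $(\mathcal{L}\varphi)(x)=\sum_{y\in\mathbb{Z}^d:|x-y|=1}\varphi(y)$ is the discrete Laplacian (with no diagonal term), so $\sigma(\mathcal{L})=[-2d,2d]$, and $V^{(\omega)}$ is multiplication by $x\mapsto\omega_x$. Almost surely $H^{(\omega)}$ is essentially self-adjoint on the finitely supported functions in $\ell^2(\mathbb{Z}^d)$, and $H$ is ergodic with respect to lattice translations. For a finite set $\Lambda\subset\mathbb{Z}^d$, the Dirichlet restriction of $H^{(\omega)}$ to $\ell^2(\Lambda)$ is $H_\Lambda^{(\omega)}=\mathcal{L}_\Lambda+V_\Lambda^{(\omega)}$, where $V_\Lambda^{(\omega)}$ is multiplication by $\omega_x$, $x\in\Lambda$, and $$(\mathcal{L}_\Lambda\varphi)(x)=\sum_{y\in\Lambda:\,|x-y|=1}\varphi(y)+\varphi(x)\cdot\#\{y\in\mathbb{Z}^d\setminus\Lambda:\ |x-y|=1\},\qquad x\in\Lambda .$$ The integrated density of states $N:\mathbb{R}\to\mathbb{R}$ is the (non-random) nondecreasing function given by $$N(E)=\lim_{\Lambda\uparrow\mathbb{Z}^d}\frac{1}{|\Lambda|}\operatorname{tr}_{\Lambda}\bigl(\chi_{]-\infty,E]}(H_\Lambda^{(\omega)})\bigr)$$ along a sequence of expanding cubes $\Lambda\subset\mathbb{Z}^d$, where $\operatorname{tr}_\Lambda$ is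 the trace on $\ell^2(\Lambda)$ and $\chi_B$ is the indicator function of $B$. By ergodicity this limit relation holds for all continuity points $E$ of $N$ and all $\omega$ outside a $\mathbb{P}$-null set that can be chosen independently of $E$. The density $\rho$ is not assumed to be essentially bounded or compactly supported, and $[W_-,W_+]$ need not be the whole support of $\rho$. *)

(* Defs.v *)
From HB Require Import structures.
From mathcomp Require Export all_boot all_order all_algebra finmap.
From mathcomp Require Export all_classical all_reals all_analysis ess_sup_inf complex.

Set Implicit Arguments.
Unset Strict Implicit.
Unset Printing Implicit Defensive.

Import Order.TTheory GRing.Theory Num.Theory.
Import numFieldNormedType.Exports.

Local Open Scope classical_set_scope.
Local Open Scope fset_scope.
Local Open Scope complex_scope.
Local Open Scope ring_scope.

Section Lattice.
Variable d : nat.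
Implicit Types (x y : 'rV[int]_d) (L : {fset 'rV[int]_d}).

(* |x - y| = 1 for the Euclidean norm of Z^d, squared to stay in the integers *)
Definition adj x y : bool := \sum_(i < d) (x 0 i - y 0 i) ^+ 2 == 1.

Definition boundary_degree L x : nat :=
  #|` fset_set [set y | y \notin L /\ adj x y]|.

Definition is_cube L : Prop :=
  exists (a : 'rV[int]_d) (l : nat), forall x,
    (x \in L) = [forall i, a 0 i <= x 0 i < a 0 i + l%:Z].

Definition expanding_cubes (L : nat -> {fset 'rV[int]_d}) : Prop :=
  [/\ forall k, is_cube (L k),
      forall k, L k `<=` L k.+1
    & forall x, exists k, x \in L k].

End Lattice.

Section FiniteVolume.
Variables (R : realType) (d : nat).
Implicit Types (L : {fset 'rV[int]_d}) (v : 'rV[int]_d -> R).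

(* Operators on the complex space l^2(L) are given by their matrices in the
   canonical basis, the sites of L being enumerated by 'I_#|L|. *)
Definition site L (i : 'I_#|{: L}|) : 'rV[int]_d := val (enum_val i).

Definition dirichlet_laplacian L : 'M[R[i]]_#|{: L}| :=
  \matrix_(i, j) ((adj (site i) (site j))%:R
    + (boundary_degree L (site i))%:R *+ (i == j)).

Definition potential L v : 'M[R[i]]_#|{: L}| :=
  diag_mx (\row_i (v (site i))%:C).

Definition dirichlet_hamiltonian L v : 'M[R[i]]_#|{: L}| :=
  dirichlet_laplacian L + potential L v.

(* Functional calculus f(A) of a Hermitian matrix A through the unitary
   diagonalization A = U^-1 D U; D is real, so that Re loses nothing. *)
Definition hermitian_calculus n (f : R -> R) (A : 'M[R[i]]_n) : 'M[R[i]]_n :=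
  invmx (spectralmx A)
    *m diag_mx (map_mx (fun z : R[i] => (f (complex.Re z))%:C) (spectral_diag A))
    *m spectralmx A.

Definition spectral_trace L v (E : R) : R :=
  complex.Re (\tr (hermitian_calculus \1_[set` `]-oo, E]]
                     (dirichlet_hamiltonian L v))).

End FiniteVolume.

Section Probability.
Context {d0 : measure_display} {T : measurableType d0} {R : realType}.
Variable P : probability T R.

Definition mutually_independent (I : choiceType) (X : I -> {RV P >-> R}) : Prop :=
  forall (s : {fset I}) (B : I -> set R), (forall i, measurable (B i)) ->
    P (\bigcap_(i in [set` s]) (X i @^-1` B i))
    = (\prod_(i <- s) P (X i @^-1` B i))%E.

Definition identically_distributed (I : choiceType) (X : I -> {RV P >-> R}) : Prop :=
  forall i j (B : set R), measurable B ->
    distribution P (X i) B = distribution P (X j) B.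

Definition has_density (X : {RV P >-> R}) (rho : R -> R) : Prop :=
  [/\ measurable_fun setT rho, forall w, 0 <= rho w
    & forall B : set R, measurable B ->
        distribution P X B = (\int[lebesgue_measure]_(w in B) (rho w)%:E)%E].

(* On the set of continuity points of N the limit determines N; the
   exceptional null set does not depend on the energy E. *)
Definition is_integrated_dos (d : nat) (omega : 'rV[int]_d -> {RV P >-> R})
    (L : nat -> {fset 'rV[int]_d}) (N : R -> R) : Prop :=
  {homo N : x y / x <= y} /\
  {ae P, forall t, forall E : R, {for E, continuous N} ->
    (fun k => (#|` L k|%:R)^-1 * spectral_trace (L k) (omega ^~ t) E)
      @ \oo --> N E}.

End Probability.

Section RealFunctions.
Variable R : realType.

(* essential infimum of rho over the interval [a, b] only *)
Definition ess_inf_itv (rho : R -> R) (a b : R) : \bar R :=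
  ess_inf (mrestr (@lebesgue_measure R) (measurable_itv `[a, b]))
    (EFin \o rho).

Definition abs_continuous_on (a b : R) (f : R -> R) : Prop :=
  forall e : R, 0 < e -> exists2 h : R, 0 < h &
    forall (n : nat) (u v : 'I_n -> R),
      (forall i, [/\ a <= u i, u i <= v i & v i <= b]) ->
      trivIset setT (fun i => [set` `]u i, v i[]) ->
      \sum_i (v i - u i) < h -> \sum_i `|f (v i) - f (u i)| < e.

(* For monotone bounded functions, such as an integrated density of states,
   absolute continuity on every compact interval is the same as on the line. *)
Definition abs_continuous (f : R -> R) : Prop :=
  forall a b : R, a <= b -> abs_continuous_on a b f.

End RealFunctions.

(* Main.v *)
Require Import Defs.
From HB Require Import structures.
From mathcomp Require Import all_boot all_order all_algebra finmap.
From mathcomp Require Import all_classical all_reals all_analysis ess_sup_inf complex.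
From mathcomp Require Import measurable_realfun ring lra zify.
Import Order.TTheory GRing.Theory Num.Theory.
Import numFieldNormedType.Exports.

(** The eigenvalue count F(E; v) of a finite-volume Hamiltonian with potential v
    depends on v and E only through v - E, and is monotone.  Put h = eps / 2 and
    round the potential down to the grid hZ; then F(E + eps) - F(E) is at least the
    increase of F(E) when the rounded potential is lowered by h everywhere.  Lower
    it block by block, on disjoint cubes of a fixed side.  For one cube, average
    over the lines on which the potential of the cube moves rigidly, by steps of
    h, inside a subinterval of [W_-, W_+] while the rest is frozen: the increments
    telescope, and the total increment is at least 1 by the min-max principle,
    because a truncated plane wave is an approximate eigenvector supported well
    inside the cube, so that an eigenvalue must cross E whatever the potential is
    outside.  A point of a line has probability at least (r h)^|cube| times the
    weight of the frozen sites, where r bounds the density from below, and there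
    are about (delta / h)^(|cube| - 1) lines, so each cube contributes at least a
    constant times h to the expectation.  Dividing by the volume and passing to the
    limit gives N(E + eps) - N(E) >= C eps.  Finally N is differentiable almost
    everywhere, since its Stieltjes measure is absolutely continuous
    (Radon-Nikodym and Lebesgue differentiation). *)

Set Implicit Arguments.
Unset Strict Implicit.
Unset Printing Implicit Defensive.

Local Open Scope classical_set_scope.
Local Open Scope ring_scope.

(** * Min-max comparison of eigenvalue counts *)

Section MinMax.
Local Open Scope sesquilinear_scope.
Variables (C : numClosedFieldType) (n : nat).
Implicit Types (A : 'M[C]_n) (u : 'rV[C]_n) (E : C).

Definition herm_form A u : C := (u *m A *m u^t*) 0 0.

(** Eigenvalues are counted with multiplicity. The energy lives in [C] together with the matrices,
    but [C] is only partially ordered, so the count is meant for real [E]. *)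
Definition eig_le A E : nat := #|[set i | spectral_diag A 0 i <= E]%SET|.

Lemma herm_formD A B u : herm_form (A + B) u = herm_form A u + herm_form B u.
Proof. by rewrite /herm_form mulmxDr mulmxDl !mxE. Qed.

Lemma herm_form_diag (d : 'rV[C]_n) u :
  herm_form (diag_mx d) u = \sum_i d 0 i * `|u 0 i| ^+ 2.
Proof.
rewrite /herm_form mul_mx_diag mxE; apply: eq_bigr => i _.
by rewrite !mxE normCK; ring.
Qed.

Lemma herm_form_spectral A E u : A \is hermsymmx ->
  herm_form (A - E%:M) u = \sum_i (spectral_diag A 0 i - E)
                              * `|(u *m (spectralmx A)^t*) 0 i| ^+ 2.
Proof.
move=> /hermitian_normalmx/orthomx_spectralP {1}->.
have PU := spectral_unitarymx A.
set P := spectralmx A in PU *; set d := spectral_diag A.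
rewrite invmx_unitary //.
have -> : E%:M = P^t* *m diag_mx (const_mx E) *m P :> 'M[C]_n.
  rewrite diag_const_mx -mulmxA -scalar_mxC mulmxA -invmx_unitary //.
  by rewrite mulVmx ?mul1mx // unitarymx_unit.
rewrite -mulmxBl -mulmxBr -linearB /=.
have -> : herm_form (P^t* *m diag_mx (d - const_mx E) *m P) u
        = herm_form (diag_mx (d - const_mx E)) (u *m P^t*).
  by rewrite /herm_form trmx_mul map_mxM trmxCK !mulmxA.
by rewrite herm_form_diag; apply: eq_bigr => i _; rewrite !mxE.
Qed.

(** If [m] exceeded the count, some nonzero vector of the space would be orthogonal to every
    eigenvector with eigenvalue at most [E]. On it the form is a sum of nonnegative terms, so
    nonpositivity makes all its spectral coordinates vanish. *)
Lemma dim_le_eig A E m (V : 'M[C]_(m, n)) : A \is hermsymmx -> E \is Num.real ->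
    row_free V -> (forall u : 'rV_m, herm_form (A - E%:M) (u *m V) <= 0) ->
  (m <= eig_le A E)%N.
Proof.
move=> hA hE fV Vneg; rewrite leqNgt; apply/negP => ltm.
set S := [set i | spectral_diag A 0 i <= E]%SET in ltm.
pose y := V *m (spectralmx A)^t*.
pose M : 'M[C]_(m, #|S|) := colsub enum_val y.
have : kermx M != 0.
  rewrite kermx_eq0 -row_leq_rank -ltnNge.
  exact: leq_ltn_trans (rank_leq_col M) ltm.
case/rowV0Pn => x /sub_kermxP xM0 /negP; apply; apply/eqP.
have xS i : i \in S -> (x *m y) 0 i = 0.
  move=> iS; move/rowP/(_ (enum_rank_in iS i)): xM0.
  by rewrite /M mulmx_colsub !mxE => /=; rewrite enum_rankK_in.
have rd i : spectral_diag A 0 i \is Num.real.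
  by have /mxOverP := hermitian_spectral_diag_real hA.
have := Vneg x; rewrite herm_form_spectral // -mulmxA -/y.
have ge0 i : 0 <= (spectral_diag A 0 i - E) * `|(x *m y) 0 i| ^+ 2.
  have [iS|iS] := boolP (i \in S); first by rewrite xS // normr0 expr0n mulr0.
  rewrite mulr_ge0 ?exprn_ge0 // subr_ge0 ltW //.
  by move: iS; rewrite inE -real_ltNge.
move=> le0.
have /eqP : \sum_i (spectral_diag A 0 i - E) * `|(x *m y) 0 i| ^+ 2 = 0.
  by apply/eqP; rewrite eq_le le0 sumr_ge0.
rewrite psumr_eq0 // => /allP all0.
have : x *m y = 0.
  apply/rowP => i; rewrite [RHS]mxE; have [iS|iS] := boolP (i \in S); first exact: xS.
  have := all0 i (mem_index_enum i); rewrite implyTb mulf_eq0 subr_eq0.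
  case/orP => [/eqP dE|]; last by rewrite sqrf_eq0 normr_eq0 => /eqP.
  by move: iS; rewrite inE dE lexx.
move/eqP; rewrite /y mulmxA mulmx_free_eq0; last first.
  rewrite /row_free mxrank_unitary // trmxC_unitary; exact: spectral_unitarymx.
by rewrite mulmx_free_eq0 // => /eqP.
Qed.

(** The eigenvectors with eigenvalue at most [E] span such a space. With [dim_le_eig], for real [E]
    the count is the largest dimension of a space on which the form is nonpositive, so counts are
    compared through forms alone. *)
Lemma eig_le_dim A E : A \is hermsymmx ->
  exists2 V : 'M[C]_(eig_le A E, n), row_free V &
    forall u : 'rV_(eig_le A E), herm_form (A - E%:M) (u *m V) <= 0.
Proof.
move=> hA; rewrite /eig_le; set S := [set i | _]%SET.
have PU := spectral_unitarymx A.
exists (rowsub (enum_val : 'I_#|S| -> _) (spectralmx A)).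
  rewrite -[X in rowsub _ X]mul1mx -mul_rowsub_mx /row_free mxrankMfree.
    apply/row_freeP; exists (rowsub (enum_val : 'I_#|S| -> _) 1%:M)^T.
    apply/matrixP => i j; rewrite !mxE (bigD1 (enum_val i)) //=.
    rewrite !mxE eqxx mul1r big1 ?addr0; last first.
      by move=> k /negPf ki; rewrite !mxE [enum_val i == k]eq_sym ki mul0r.
    by rewrite (inj_eq enum_val_inj) eq_sym.
  by rewrite /row_free mxrank_unitary.
move=> u; rewrite herm_form_spectral // -mulmxA.
rewrite [rowsub _ _ *m _](_ : _ = rowsub (enum_val : 'I_#|S| -> _) 1%:M); last first.
  by rewrite mul_rowsub_mx (unitarymxP _).
rewrite -oppr_ge0 -sumrN sumr_ge0 // => i _; rewrite -mulNr opprB.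
have [iS|iS] := boolP (i \in S).
  by rewrite mulr_ge0 ?exprn_ge0 // subr_ge0; rewrite inE in iS.
rewrite [X in `|X|](_ : _ = 0) ?normr0 ?expr0n ?mulr0 //.
rewrite mxE big1 // => j _; rewrite !mxE; case: eqP => [ji|_]; last by rewrite mulr0.
by move: iS; rewrite -ji enum_valP.
Qed.


Lemma hermsymmx_diag A (v : 'rV[C]_n) :
  A \is hermsymmx -> v \is a realmx -> A + diag_mx v \is hermsymmx.
Proof.
move=> /is_hermitianmxP; rewrite expr0 scale1r => hA /mxOverP hv.
apply/is_hermitianmxP; rewrite expr0 scale1r {1}hA; apply/matrixP => i j.
rewrite !mxE [RHS]rmorphD /= [X in _ = _ + X]rmorphMn /= eq_sym; congr +%R.
by case: eqP => // ->; rewrite !mulr1n (CrealP _).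
Qed.

Lemma eig_le_max A E : (eig_le A E <= n)%N.
Proof. by rewrite -[X in (_ <= X)%N](card_ord n) max_card. Qed.

Lemma le_eig_le A B E F : A \is hermsymmx -> B \is hermsymmx ->
    E \is Num.real -> F \is Num.real ->
    (forall u, herm_form (B - F%:M) u <= herm_form (A - E%:M) u) ->
  (eig_le A E <= eig_le B F)%N.
Proof.
move=> hA hB hE hF le_form; have [V fV Vneg] := eig_le_dim E hA.
apply: dim_le_eig fV _ => // u; exact: le_trans (le_form _) (Vneg u).
Qed.

Lemma eig_le_diag A E F (v w : 'rV[C]_n) : A \is hermsymmx ->
    v \is a realmx -> w \is a realmx -> E \is Num.real -> F \is Num.real ->
    (forall i, w 0 i - F <= v 0 i - E) ->
  (eig_le (A + diag_mx v) E <= eig_le (A + diag_mx w) F)%N.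
Proof.
move=> hA hv hw hE hF le_vw; apply: le_eig_le => //; do ?exact: hermsymmx_diag.
have diagB (z : 'rV[C]_n) G : A + diag_mx z - G%:M = A + diag_mx (z - const_mx G).
  by rewrite linearB /= diag_const_mx addrA.
move=> u; rewrite !diagB !herm_formD lerD2l.
by rewrite !herm_form_diag ler_sum // => i _; rewrite !mxE ler_wpM2r ?exprn_ge0.
Qed.

(** Weighted arithmetic-geometric mean inequality, from expanding the square of [a - eta * b]. *)
Lemma re_mul_le (eta a b : C) : 0 < eta ->
  a * b^* + b * a^* <= `|a| ^+ 2 / eta + eta * `|b| ^+ 2.
Proof.
move=> eta0; have rE : eta^* = eta by rewrite (CrealP _) // gtr0_real.
rewrite -subr_ge0.
have -> : `|a| ^+ 2 / eta + eta * `|b| ^+ 2 - (a * b^* + b * a^*)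
        = `|a - eta * b| ^+ 2 / eta.
  rewrite !normCK rmorphB rmorphM /= rE; field; exact: lt0r_neq0.
by rewrite divr_ge0 ?exprn_ge0 // ltW.
Qed.

Lemma herm_formE A u : herm_form A u = \sum_i (u *m A) 0 i * (u 0 i)^*.
Proof. by rewrite /herm_form mxE; apply: eq_bigr => i _; rewrite !mxE. Qed.

Lemma herm_form_real A u : A \is hermsymmx -> herm_form A u \is Num.real.
Proof.
move=> /is_hermitianmxP; rewrite expr0 scale1r => hA; apply/CrealP.
have : (u *m A *m u^t*)^t* = u *m A *m u^t*.
  by rewrite !trmx_mul !map_mxM trmxCK -hA mulmxA.
by move/matrixP/(_ 0 0); rewrite [LHS]mxE mxE.
Qed.

Lemma herm_formDr A u w : A \is hermsymmx ->
  herm_form A (u + w) = herm_form A u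
    + \sum_i ((w *m A) 0 i * (u 0 i)^* + u 0 i * ((w *m A) 0 i)^*)
    + \sum_i (w *m A) 0 i * (w 0 i)^*.
Proof.
move=> /is_hermitianmxP; rewrite expr0 scale1r => hA.
have E (x y : 'rV[C]_n) : (x *m A *m y^t*) 0 0 = \sum_i (x *m A) 0 i * (y 0 i)^*.
  by rewrite mxE; apply: eq_bigr => i _; rewrite !mxE.
have E' (x y : 'rV[C]_n) : (x *m A *m y^t*) 0 0 = \sum_i x 0 i * ((y *m A) 0 i)^*.
  rewrite -mulmxA (_ : A *m y^t* = (y *m A)^t*) ?mxE; last by rewrite trmx_mul map_mxM -hA.
  by apply: eq_bigr => i _; rewrite !mxE.
rewrite big_split /= -!E -E' /herm_form !mulmxDl linearD /= map_mxD !mulmxDr !mxE.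
by ring.
Qed.

(* With [x] the restriction of a test vector to [B] and [p] a multiple of [phi],
   adding the line of [phi] to the nonpositive space of [A + diag_mx v] keeps the
   form of [A + diag_mx w] nonpositive, because it is at most
   [- alpha (|x|^2 + |x + p|^2) + 5 eta (|x|^2 + |x + p|^2)], whatever the
   potential is outside [B]. *)
Lemma eig_le_cross A E (B : {set 'I_n}) (phi : 'rV[C]_n) (v w : 'rV[C]_n)
    (e eta alpha : C) :
    A \is hermsymmx -> v \is a realmx -> w \is a realmx ->
    E \is Num.real -> e \is Num.real ->
    0 < eta -> 5 * eta <= alpha -> phi != 0 ->
    (forall i, i \notin B -> phi 0 i = 0) ->
    (forall i, i \notin B -> (phi *m (A - (E - e)%:M)) 0 i = 0) ->
    \sum_i `|(phi *m (A - (E - e)%:M)) 0 i| ^+ 2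
      <= eta ^+ 2 * \sum_i `|phi 0 i| ^+ 2 ->
    (forall i, i \notin B -> w 0 i = v 0 i) ->
    (forall i, i \in B -> e + alpha <= v 0 i) ->
    (forall i, i \in B -> w 0 i <= e - alpha) ->
  ((eig_le (A + diag_mx v) E).+1 <= eig_le (A + diag_mx w) E)%N.
Proof.
move=> hA hv hw hE he eta0 eta_alpha phi0 phiB rB rle wv vB wB.
pose r := phi *m (A - (E - e)%:M); rewrite -/r in rB rle.
(* The reference potential is [e] on [B] and the common value of [v] and [w] outside: then [H] sends
   [phi] to the residual [r], and differs from the two shifted operators only on [B]. *)
pose z : 'rV[C]_n := \row_i (if i \in B then e else v 0 i).
have rl : alpha \is Num.real.
  by rewrite (ger_real eta_alpha) // realM ?realn // gtr0_real.
have hz : z \is a realmx.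
  by apply/mxOverP => i j; rewrite mxE; case: ifP => // _; rewrite (mxOverP hv).
pose H := A + diag_mx z - E%:M.
have hH : H \is hermsymmx.
  rewrite /H -addrA -diag_const_mx -linearN -linearD /=.
  apply: hermsymmx_diag => //; apply/mxOverP => i j; rewrite !mxE realB //.
  by case: ifP => // _; rewrite (mxOverP hv).
have phiH : phi *m H = r.
  apply/rowP => i; rewrite /H /r !mulmxBr mulmxDr mul_mx_diag !mul_mx_scalar !mxE.
  by case: ifP => [iB|/negbT iB]; [ring|rewrite (phiB i iB); ring].
pose Np := \sum_i `|phi 0 i| ^+ 2.
have Np_gt0 : 0 < Np.
  have [i phii] : exists i, phi 0 i != 0.
    apply/existsP; apply: contraNT phi0 => /existsPn phi_0.
    by apply/eqP/rowP => i; rewrite mxE; apply/eqP; have := phi_0 i; rewrite negbK.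
  by rewrite /Np (bigD1 i) //= ltr_wpDr ?sumr_ge0 // ?exprn_gt0 ?normr_gt0.
have hv' := hermsymmx_diag hA hv; have hw' := hermsymmx_diag hA hw.
have alpha0 : 0 < alpha by apply: lt_le_trans eta_alpha; rewrite mulr_gt0.
have formv u : alpha * \sum_(i in B) `|u 0 i| ^+ 2
    <= herm_form (A + diag_mx v - E%:M) u - herm_form H u.
  have -> : A + diag_mx v - E%:M = H + diag_mx (v - z).
    by rewrite /H linearB /= [RHS]addrAC [in RHS]addrACA subrr addr0.
  rewrite herm_formD addrAC subrr add0r herm_form_diag big_distrr /=.
  rewrite [leRHS](bigID (mem B)) /= [X in _ + X]big1 ?addr0; last first.
    by move=> i /negPf iB; rewrite !mxE iB subrr mul0r.
  apply: ler_sum => i iB; rewrite ler_wpM2r ?exprn_ge0 // !mxE iB.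
  by rewrite lerBrDl vB.
have formw u : herm_form (A + diag_mx w - E%:M) u <=
    herm_form H u - alpha * \sum_(i in B) `|u 0 i| ^+ 2.
  have -> : A + diag_mx w - E%:M = H + diag_mx (w - z).
    by rewrite /H linearB /= [RHS]addrAC [in RHS]addrACA subrr addr0.
  rewrite herm_formD lerD2l herm_form_diag big_distrr /= -sumrN.
  rewrite [leLHS](bigID (mem B)) /= [X in _ + X]big1 ?addr0; last first.
    by move=> i iB; rewrite !mxE (negPf iB) wv // subrr mul0r.
  apply: ler_sum => i iB; rewrite -mulNr ler_wpM2r ?exprn_ge0 // !mxE iB.
  by rewrite lerBlDl wB.
have sumB (f : 'I_n -> C) : (forall i, i \notin B -> f i = 0) ->
    \sum_i f i = \sum_(i in B) f i.
  by move=> f0; rewrite (bigID (mem B)) /= [X in _ + X]big1 ?addr0.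
pose Q (p : 'rV[C]_n) := \sum_(i in B) `|p 0 i| ^+ 2 : C.
have rH c : c *: phi *m H = c *: r by rewrite -scalemxAl phiH.
have rcle c : \sum_(i in B) `|(c *: r) 0 i| ^+ 2 / eta <= eta * Q (c *: phi).
  rewrite -mulr_suml ler_pdivrMr // mulrAC -expr2.
  under eq_bigr do rewrite mxE normrM exprMn.
  rewrite /Q; under [X in _ <= _ * X]eq_bigr do rewrite mxE normrM exprMn.
  rewrite -!mulr_sumr mulrCA ler_wpM2l ?exprn_ge0 //.
  move: rle; rewrite (sumB (fun i => `|r 0 i| ^+ 2)) => [|i iB]; last first.
    by rewrite rB // normr0 expr0n.
  rewrite (sumB (fun i => `|phi 0 i| ^+ 2)) => // i iB.
  by rewrite phiB // normr0 expr0n.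
have cross u c : \sum_i ((c *: r) 0 i * (u 0 i)^* + u 0 i * ((c *: r) 0 i)^*)
    <= eta * Q (c *: phi) + eta * Q u.
  rewrite sumB => [|i iB]; last by rewrite mxE rB // mulr0 conjC0 mul0r mulr0 addr0.
  apply: le_trans (ler_sum _ _) _; first by move=> i _; exact: re_mul_le eta0.
  by rewrite big_split /= -mulr_sumr lerD2r.
have self c : `|herm_form H (c *: phi)| <= eta * Q (c *: phi).
  have rF := herm_form_real (c *: phi) hH.
  have F2 : herm_form H (c *: phi) *+ 2 = \sum_i ((c *: r) 0 i * ((c *: phi) 0 i)^* 
      + (c *: phi) 0 i * ((c *: r) 0 i)^*).
    rewrite big_split /= mulr2n; congr +%R; first by rewrite herm_formE rH.
    rewrite -{1}(CrealP rF) herm_formE rH rmorph_sum /=; apply: eq_bigr => i _.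
    by rewrite rmorphM /= conjCK mulrC.
  have Fle : herm_form H (c *: phi) <= eta * Q (c *: phi).
    by rewrite -(ler_pMn2r (ltn0Sn 1)) F2 mulr2n cross.
  rewrite real_ler_norml // Fle andbT lerNl -(ler_pMn2r (ltn0Sn 1)) mulNrn F2 -sumrN.
  rewrite [leLHS](_ : _ = \sum_i ((c *: r) 0 i * ((- c *: phi) 0 i)^* 
      + (- c *: phi) 0 i * ((c *: r) 0 i)^*)).
    apply: le_trans (cross _ _) _; rewrite mulr2n lerD2l ler_pM2l //.
    by rewrite le_eqVlt; apply/orP/or_introl/eqP/eq_bigr => i _; rewrite !mxE mulNr normrN.
  by apply: eq_bigr => i _; rewrite !mxE mulNr rmorphN mulrN mulNr opprD.
have QE c : Q (c *: phi) = `|c| ^+ 2 * Np.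
  rewrite /Np (sumB (fun i => `|phi 0 i| ^+ 2)) /Q => [|i iB]; last first.
    by rewrite phiB // normr0 expr0n.
  by rewrite mulr_sumr; apply: eq_bigr => i _; rewrite mxE normrM exprMn.
have Q_ge0 u : 0 <= Q u by rewrite sumr_ge0 // => i _; rewrite exprn_ge0.
have [V fV Vneg] := eig_le_dim E hv'.
rewrite -addn1.
apply: (@dim_le_eig _ _ _ (col_mx V phi)) => //.
  rewrite -kermx_eq0; apply/eqP/row_matrixP => i; rewrite row0.
  have : (row i (kermx (col_mx V phi)) <= kermx (col_mx V phi))%MS by exact: row_sub.
  set x := row i _; move=> /sub_kermxP; rewrite -[x]hsubmxK.
  set x1 := lsubmx x; set x2 := rsubmx x; rewrite mul_row_col [x2]mx11_scalar mul_scalar_mx.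
  set c := x2 0 0 => /eqP; rewrite addr_eq0 => /eqP x1V.
  (* Otherwise a nonzero multiple of [phi] lies in the nonpositive space for [v], and [formv] with
     [self] gives [alpha <= eta], against [5 * eta <= alpha]. *)
  have c0 : c = 0.
    apply/eqP/negPn/negP => c_neq0; have := Vneg x1; rewrite x1V -scaleNr.
    move=> le0; have := formv (- c *: phi); rewrite -/(Q _) => le1.
    have : alpha * Q (- c *: phi) <= eta * Q (- c *: phi).
      apply: le_trans le1 _; apply: le_trans (self (- c)).
      apply: le_trans (lerD le0 (lexx _)) _.
      by rewrite add0r -normrN real_ler_norm ?rpredN ?herm_form_real.
    rewrite QE normrN ler_pM2r ?mulr_gt0 ?exprn_gt0 ?normr_gt0 // => /(le_trans eta_alpha).
    by rewrite ger_pMl // lern1.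
  by move: x1V; rewrite c0 scale0r oppr0 => /eqP; rewrite mulmx_free_eq0 // => /eqP ->;
     rewrite raddf0 row_mx0.
move=> u; rewrite -[u]hsubmxK mul_row_col [rsubmx u]mx11_scalar mul_scalar_mx.
set x := lsubmx u *m V; set c := rsubmx u 0 0; set p := c *: phi.
apply: le_trans (formw _) _; rewrite -/(Q _) herm_formDr // -herm_formE rH.
have le_x : herm_form H x <= - (alpha * Q x).
  have := formv x; rewrite -/(Q _) lerBrDr -lerBrDl => /le_trans; apply.
  by rewrite gerDr Vneg.
have le_p : Q p <= 2 * (Q x + Q (x + p)).
  rewrite -big_split /= mulr_sumr ler_sum // => i _.
  have -> : (x + p) 0 i = x 0 i + p 0 i by rewrite mxE.
  rewrite -subr_ge0 [leRHS](_ : _ = `|2 * x 0 i + p 0 i| ^+ 2) ?exprn_ge0 //.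
  by rewrite !normCK !rmorphD rmorphM /= rmorph_nat; ring.
have le_self : herm_form H p <= eta * Q p.
  by apply: le_trans (self c); rewrite real_ler_norm // herm_form_real.
have le_all : herm_form H x + \sum_i ((c *: r) 0 i * (x 0 i)^* + x 0 i * ((c *: r) 0 i)^*)
    + herm_form H p <= - (alpha * Q x) + (eta * Q p + eta * Q x) + eta * Q p.
  by rewrite !lerD.
apply: le_trans (lerD le_all (lexx _)) _.
have : 2 * (eta * Q p) <= 2 * (eta * (2 * (Q x + Q (x + p)))).
  by rewrite ler_pM2l // ler_pM2l.
rewrite -subr_ge0 => h1.
have h2 : 0 <= (alpha - 5 * eta) * (Q x + Q (x + p)) + eta * Q (x + p).
  by rewrite addr_ge0 ?mulr_ge0 ?subr_ge0 ?addr_ge0 // ltW.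
rewrite -oppr_ge0; apply: le_trans (addr_ge0 h1 h2) _.
by rewrite le_eqVlt; apply/orP/or_introl/eqP; ring.
Qed.

End MinMax.

(** * Sums over blocks and lines of configurations *)

Section BlockSum.
Variables (R : realFieldType) (n p : nat) (F : ('I_n -> R) -> R).
Variables (B : 'I_p -> {set 'I_n}) (x0 : 'I_p -> 'I_n) (h : R).
Variables (T0 M : int) (I tau m : nat).
Hypothesis B_disj : forall i j x, x \in B i -> x \in B j -> i = j.
Hypothesis x0B : forall j, x0 j \in B j.

(* The potential [h * K] lowered by [h] on the first [k] blocks: going from [k] to
   [k.+1] isolates the contribution of the block [k]. *)
Definition shifted (k : nat) (K : 'I_n -> int) (x : 'I_n) : R :=
  h * (K x - [exists j : 'I_p, (j < k)%N && (x \in B j)]%:Z)%:~R.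

Definition block_gain (j : 'I_p) (K : 'I_n -> int) : R :=
  F (shifted j.+1 K) - F (shifted j K).

(* For [t] from [0] to [tau], the block [j] is moved rigidly while the outside is
   fixed; the site [x0 j] serves as origin, which makes the parametrization of
   the configurations by [t] and [u] injective. *)
Definition line (j : 'I_p) (t : nat) (u : {ffun 'I_n -> 'I_m}) : {ffun 'I_n -> int} :=
  [ffun x => if x \in B j then T0 + t%:Z + (u x)%:Z else (u x)%:Z - M].

(** The offsets allowed at a site: none at the origin, at most [I] grid steps elsewhere in the
    block, so that its values stay close together while crossing the window, and anything outside
    the block. *)
Definition line_base (j : 'I_p) (x : 'I_n) : pred 'I_m := fun a =>
  if x == x0 j then a == 0%N :> nat else (x \in B j) ==> (a <= I)%N.

Lemma line_inj j (t t' : nat) u u' :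
  u \in family (line_base j) -> u' \in family (line_base j) ->
  line j t.+1 u = line j t'.+1 u' -> t = t' /\ u = u'.
Proof.
move=> /familyP uj /familyP uj' /ffunP E.
have u0 : u (x0 j) = 0%N :> nat.
  by have := uj (x0 j); rewrite unfold_in /line_base eqxx => /eqP.
have u0' : u' (x0 j) = 0%N :> nat.
  by have := uj' (x0 j); rewrite unfold_in /line_base eqxx => /eqP.
have tt' : t = t'.
  by have := E (x0 j); rewrite !ffunE x0B u0 u0'; lia.
split=> //; apply/ffunP => x; apply: val_inj.
by have := E x; rewrite !ffunE tt'; case: ifP => _ /=; lia.
Qed.

Hypothesis F_anti : forall v w, (forall x, w x <= v x) -> F v <= F w.
Hypothesis h_ge0 : 0 <= h.

Lemma shifted0 K x : shifted 0 K x = h * (K x)%:~R.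
Proof. by rewrite /shifted (_ : [exists j, _] = false) ?subr0 //; apply/existsP => -[]. Qed.

Lemma shifted_ge k K x : h * (K x - 1)%:~R <= shifted k K x.
Proof. by rewrite ler_wpM2l // ler_int lerD2l lerN2; case: [exists _, _]. Qed.

Lemma sum_block_gain K :
  \sum_j block_gain j K = F (shifted p K) - F (shifted 0 K).
Proof.
rewrite /block_gain -(big_mkord xpredT (fun j => F (shifted j.+1 K) - F (shifted j K))).
by rewrite telescope_sumr.
Qed.

Lemma block_gain_ge0 j K : 0 <= block_gain j K.
Proof.
rewrite subr_ge0; apply: F_anti => x; rewrite ler_wpM2l // ler_int lerD2l lerN2.
case: (boolP [exists i : 'I_p, (i < j)%N && _]) => [/existsP[i /andP[ij xi]]|_]; last first.
  by case: [exists _, _].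
by rewrite (_ : [exists _, _]) //; apply/existsP; exists i; rewrite xi ltnW.
Qed.

(** Earlier blocks do not meet the block [j], and the outside is frozen, so lowering the block [j]
    just undoes one step along the line. This makes the gains telescope. *)
Lemma shifted_lineS (j : 'I_p) t u : shifted j.+1 (line j t.+1 u) =1 shifted j (line j t u).
Proof.
move=> x; congr (_ * _%:~R); rewrite !ffunE; case: ifP => xj.
  rewrite (_ : [exists _, _]); last by apply/existsP; exists j; rewrite xj ltnSn.
  rewrite (_ : [exists _, _] = false) //=; first by lia.
  by apply/existsP => -[i /andP[+ xi]]; rewrite (B_disj xi xj) ltnn.
congr (_ - (nat_of_bool _)%:Z); apply: eq_existsb => i.
by rewrite ltnS leq_eqVlt; case: eqP => // /val_inj ->; rewrite xj !andbF.
Qed.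

Lemma sum_line_gain j u :
  \sum_(t < tau) block_gain j (line j t.+1 u)
  = F (shifted j (line j 0 u)) - F (shifted j (line j tau u)).
Proof.
have F_eq v w : v =1 w -> F v = F w.
  by move=> vw; apply/eqP; rewrite eq_le !F_anti // => x; rewrite vw.
rewrite (eq_bigr (fun t : 'I_tau => - F (shifted j (line j t.+1 u))
    - - F (shifted j (line j t u)))); last first.
  by move=> t _; rewrite /block_gain (F_eq _ _ (shifted_lineS j t u)) opprK addrC.
rewrite -(big_mkord xpredT (fun t => - F (shifted j (line j t.+1 u)) -
  - F (shifted j (line j t u)))) telescope_sumr // opprK addrC //.
Qed.

(** By injectivity at most one term is nonzero. It is used for a configuration [k], which lies on at
    most one line of a given block. *)
Lemma sum_indic_le (J : finType) (A : pred J) (U : eqType) (f : U -> R) (K : J -> U) k :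
  {in A &, injective K} -> 0 <= f k ->
  \sum_(i | A i) f (K i) * (K i == k)%:R <= f k.
Proof.
move=> Kinj fk; have [/existsP[i /andP[Ai /eqP Ki]]|] := boolP [exists i, A i && (K i == k)].
  rewrite (bigD1 i) //= Ki eqxx mulr1 big1 ?addr0 // => i' /andP[Ai' ne].
  rewrite -Ki (inj_in_eq Kinj) ?unfold_in // (negPf ne) mulr0 //.
move=> /existsPn no; rewrite big1 // => i Ai.
by have := no i; rewrite Ai /= => /negPf ->; rewrite mulr0.
Qed.

(* The gains telescope along each line to an eigenvalue crossing, which is worth
   at least [1], while the weight of the sites of the block is bounded below by
   [c] uniformly on the line; the sum of the remaining weights factorizes. *)
Lemma line_gain_ge (q : 'I_n -> int -> R) (c kappa beta : R) (s : nat) j :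
    (forall x k, 0 <= q x k) ->
    (forall x k, x \in B j -> T0 <= k <= T0 + tau%:Z + I%:Z -> c <= q x k) ->
    (forall x, beta <= \sum_(a < m) q x (a%:Z - M)) ->
    (I < m)%N -> 0 <= c -> 0 <= kappa -> kappa <= 1 -> kappa <= c * I.+1%:R ->
    0 <= beta -> beta <= 1 -> (#|B j| <= s)%N ->
    (forall u, u \in family (line_base j) ->
       F (shifted j (line j tau u)) + 1 <= F (shifted j (line j 0 u))) ->
  c * kappa ^+ s * beta ^+ n <=
  \sum_(z : 'I_tau * {ffun 'I_n -> 'I_m} | z.2 \in family (line_base j))
     block_gain j (line j z.1.+1 z.2) * \prod_x q x (line j z.1.+1 z.2 x).
Proof.
move=> q0 qc qbeta Im c0 k0 k1 kc b0 b1 Bs gain1.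
(* Replacing the weights in the block by their lower bound [c] makes the weight independent of [t],
   so it factors out of the telescoping sum. *)
pose g (x : 'I_n) (a : 'I_m) : R := if x \in B j then c else q x (a%:Z - M).
have g0 x a : 0 <= g x a by rewrite /g; case: ifP.
have -> : \sum_(z : 'I_tau * {ffun 'I_n -> 'I_m} | z.2 \in family (line_base j))
     block_gain j (line j z.1.+1 z.2) * \prod_x q x (line j z.1.+1 z.2 x)
  = \sum_(u in family (line_base j)) \sum_(t < tau)
     block_gain j (line j t.+1 u) * \prod_x q x (line j t.+1 u x).
  by rewrite exchange_big pair_big /=; apply: eq_bigl => z.
apply: (@le_trans _ _ (\sum_(u in family (line_base j)) \prod_x g x (u x))); last first.
  apply: ler_sum => u uB; apply: (@le_trans _ _
    (\sum_(t < tau) block_gain j (line j t.+1 u) * \prod_x g x (u x))).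
    rewrite -mulr_suml sum_line_gain ler_peMl ?prodr_ge0 //.
    by rewrite lerBrDl gain1.
  apply: ler_sum => t _; rewrite ler_wpM2l ?block_gain_ge0 //.
  apply: ler_prod => x _; rewrite g0 /= /g ffunE; case: ifP => // xB.
  have ux : (u x <= I)%N.
    move/familyP/(_ x): uB; rewrite unfold_in /line_base xB.
    by case: eqP => // _ /eqP ->.
  by rewrite qc // -!addrA lerD2l -!PoszD lez_nat leq_add ?ltn_ord // andbT; lia.
rewrite -(bigA_distr_big_dep _ (fun x a => g x a)) /=.
(* After exchanging product and sum, each site is bounded separately: one choice of offset at the
   origin, [I.+1] choices of weight [c] elsewhere in the block, and the whole window outside. *)
pose d x := if x == x0 j then c else if x \in B j then kappa else beta.
have xj := x0B j.
apply: (@le_trans _ _ (\prod_x d x)).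
  rewrite (bigID (mem (B j))) /= (bigD1 (x0 j)) //= {1}/d eqxx.
  rewrite -!mulrA ler_wpM2l // ler_pM ?exprn_ge0 //.
    rewrite (eq_bigr (fun=> kappa)) => [|x /andP[xB /negPf xne]]; last by rewrite /d xne xB.
    rewrite prodr_const ler_wiXn2l //; apply: leq_trans Bs; apply: subset_leq_card.
    by apply/fintype.subsetP => x /andP[].
  rewrite (eq_bigr (fun=> beta)) => [|x /negPf xB]; last first.
    by rewrite /d xB; case: eqP xB => // ->; rewrite xj.
  by rewrite prodr_const ler_wiXn2l // -[leqRHS]card_ord max_card.
apply: ler_prod => x _; rewrite /d; case: (eqVneq x (x0 j)) => [->|xne].
  rewrite c0 /= (bigD1 (Ordinal (leq_ltn_trans (leq0n I) Im))) /=; last first.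
    by rewrite /line_base eqxx.
  by rewrite {1}/g xj lerDl sumr_ge0.
case: ifP => xB.
  rewrite k0 (le_trans kc) //= (eq_bigr (fun=> c)) => [|a _]; last by rewrite /g xB.
  have widenI : injective (widen_ord Im) by move=> a b /(congr1 val) /= /val_inj.
  rewrite sumr_const -[leRHS]mulr_natr ler_wpM2l // ler_nat.
  rewrite -[leqLHS]card_ord -(card_imset _ widenI).
  apply: subset_leq_card; apply/fintype.subsetP => _ /imsetP[a _ ->].
  by rewrite unfold_in /line_base (negPf xne) xB /= -ltnS.
rewrite b0 (le_trans (qbeta x)) //= [leRHS](eq_bigl xpredT); last first.
  by move=> a; rewrite /line_base (negPf xne) xB.
by apply: ler_sum => a _; rewrite /g xB.
Qed.

End BlockSum.

(** * Expectations in finite volume *)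

(** A line starts with the whole block at or below [e - delta / 2], ends with it at or above
    [e + delta / 2], and its cells stay between [e - delta] and [e + delta]; the offsets have room
    [delta / 4]. The bound [h <= delta / 8] absorbs the rounding errors. *)
Lemma grid_exists (R : realType) (e delta h : R) : 0 < h -> h <= delta / 8 ->
  exists T0 : int, exists I tau : nat,
    [/\ e - delta <= h * T0%:~R, h * (T0 + I%:Z)%:~R <= e - delta / 2,
        e + delta / 2 <= h * (T0 + tau%:Z)%:~R,
        h * (T0 + tau%:Z + I%:Z + 1)%:~R <= e + delta & delta / 4 <= h * I.+1%:R].
Proof.
move=> h0 hd.
have fl (a : R) : h * (Num.floor (a / h))%:~R <= a < h * (Num.floor (a / h) + 1)%:~R.
  by rewrite mulrC -ler_pdivlMr // [h * _]mulrC -ltr_pdivrMr // floor_itv.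
have [fl1 fl2] := (fl (e - delta), fl (e + delta)).
have fl3 := fl (delta / 4).
move: (Num.floor _) (Num.floor _) (Num.floor _) fl1 fl2 fl3 => c b a.
rewrite !intrD => /andP[a1 a2] /andP[b1 b2] /andP[c1 c2].
have c0 : 0 <= c.
  rewrite -ltzD1 -(ltr0z R) intrD -(pmulr_rgt0 _ h0); lra.
have bac : 0 <= b - c - 1 - (a + 1).
  rewrite -ltzD1 -(ltr0z R) -(pmulr_rgt0 _ h0) !(intrD, intrB); lra.
(* [a + 1] is the first grid index beyond [e - delta], [c] the number of whole steps in [delta / 4],
   and [tau] makes the last cell end at [b], the rounding down of [e + delta]. *)
exists (a + 1); exists `|c|%N; exists `|(b - c - 1 - (a + 1))%R|%N.
have cS : `|c|%N.+1%:R = c%:~R + 1 :> R by rewrite -natr1 -{2}(gez0_abs c0).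
rewrite cS !gez0_abs // !(intrD, intrB).
by split; lra.
Qed.

Lemma bernoulli_inequality (R : realDomainType) (x : R) k :
  0 <= x <= 1 -> 1 - k%:R * x <= (1 - x) ^+ k.
Proof.
move=> /andP[x0 x1]; elim: k => [|k IH]; first by rewrite mul0r subr0.
rewrite exprS; apply: (@le_trans _ _ ((1 - x) * (1 - k%:R * x))).
  by rewrite -natr1 -subr_ge0 (_ : _ - _ = k%:R * (x * x)) ?mulr_ge0 //; ring.
by rewrite ler_wpM2l // subr_ge0.
Qed.

Section FiniteVolumeEstimate.
Context {d0 : measure_display} {T : measurableType d0} {R : realType}.
Variables (P : probability T R) (n : nat) (X : 'I_n -> {RV P >-> R}).

Definition cell (h : R) (k : int) : set R := `[h * k%:~R, h * (k + 1)%:~R[%classic.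

Definition cell_event h (K : 'I_n -> int) : set T :=
  \bigcap_(x in setT) (X x @^-1` cell h (K x)).

Lemma measurable_RV (x : 'I_n) (A : set R) : measurable A -> measurable (X x @^-1` A).
Proof. by move=> mA; rewrite -[_ @^-1` _]setTI; exact: (measurable_funP (X x)). Qed.

Lemma measurable_cell_event h K : measurable (cell_event h K).
Proof.
apply: fin_bigcap_measurable => // x _.
by apply: measurable_RV; exact: measurable_itv.
Qed.

Lemma cellE h k y : 0 < h -> (cell h k y) <-> k = Num.floor (y / h).
Proof.
move=> h0; rewrite /cell /= in_itv /= mulrC -ler_pdivlMr // [h * _]mulrC -ltr_pdivrMr //.
split => [|->]; last by rewrite floor_itv.
by move=> H; apply/esym/floor_def.
Qed.

Lemma indic_cell_event h (K : {ffun 'I_n -> int}) t : 0 < h ->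
  \1_(cell_event h K) t = (K == [ffun x => Num.floor (X x t / h)])%:R :> R.
Proof.
move=> h0; rewrite indicE; congr (nat_of_bool _)%:R; apply/idP/eqP.
  by rewrite inE => H; apply/ffunP => x; rewrite ffunE; apply/(cellE _ _ h0)/H.
by move=> ->; rewrite inE => x _; apply/(cellE _ _ h0); rewrite ffunE.
Qed.

Definition cell_prob h (x : 'I_n) (k : int) : R := fine (P (X x @^-1` cell h k)).

Lemma sum_cell_prob h x (M m : nat) : 0 < h ->
  \sum_(a < m) cell_prob h x (a%:Z - M%:Z)
    = fine (P (X x @^-1` `[h * (- M%:Z)%:~R, h * (m%:Z - M%:Z)%:~R[%classic)).
Proof.
move=> h0; elim: m => [|m IH].
  by rewrite big_ord0 sub0r set_itvco0 ?preimage_set0 ?measure0.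
have mI (a b : R) : measurable (X x @^-1` `[a, b[%classic).
  by apply: measurable_RV; exact: measurable_itv.
have mC k : measurable (X x @^-1` cell h k) by exact: mI.
rewrite big_ord_recr /= IH /cell_prob -fineD ?fin_num_measure //.
rewrite -measureU //; last first.
  rewrite -preimage_setI /cell -subset0 => t /= [] /=.
  rewrite !in_itv /= => /andP[_ lt1] /andP[le2 _].
  by have := le_lt_trans le2 lt1; rewrite ltxx.
congr (fine (P _)); rewrite -preimage_setU; congr (_ @^-1` _).
rewrite /cell (_ : m%:Z - M%:Z + 1 = m.+1%:Z - M%:Z); last by rewrite intS; ring.
rewrite -itv_bndbnd_setU // bnd_simp ler_pM2l // ler_int.
  by lia.
by lia.
Qed.

Lemma prob_window_cvg (x : 'I_n) (h : R) : 0 < h ->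
  (fun M : nat => P (X x @^-1` `[h * (- M%:Z)%:~R, h * M%:R[%classic)) @ \oo --> 1%E.
Proof.
move=> h0; pose A (M : nat) := X x @^-1` `[h * (- M%:Z)%:~R, h * M%:R[%classic.
have mA M : measurable (A M) by apply: measurable_RV; exact: measurable_itv.
have -> : 1%E = P (\bigcup_M A M).
  rewrite -(@probability_setT _ _ _ P); congr (P _); apply/esym; rewrite -subTset => t _.
  exists (Num.bound (`|X x t| / h)) => //; set M := Num.bound _; rewrite /A /= in_itv /=.
  have : `|X x t| / h < M%:R by rewrite archi_boundP // divr_ge0 // ltW.
  rewrite ltr_pdivrMr // mulrC ltr_norml => /andP[lt1 ->].
  by rewrite andbT rmorphN mulrN ltW.
apply: nondecreasing_cvg_mu => //.
  by apply: bigcup_measurable => M _; exact: mA.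
move=> M M' MM'; apply/subsetPset => t; rewrite /A /= !in_itv /= !rmorphN !mulrN.
have hM : h * M%:R <= h * M'%:R by rewrite ler_pM2l // ler_nat.
move=> /andP[lt1 lt2]; rewrite (lt_le_trans lt2) // andbT.
by apply: le_trans lt1; rewrite lerN2.
Qed.

(** Only finitely many cells can be summed. As there are finitely many sites, a single window
    carries mass at least [beta] at all of them. *)
Lemma exists_window (h beta : R) (I : nat) : 0 < h -> beta < 1 ->
  exists2 M : nat, (I < M)%N &
    forall x, beta <= \sum_(a < M + M) cell_prob h x (a%:Z - M%:Z).
Proof.
move=> h0 b1; have : \forall M \near \oo, (I < M)%N /\ forall x : 'I_n, 
    beta < fine (P (X x @^-1` `[h * (- M%:Z)%:~R, h * M%:R[%classic)).
  near=> M; split; first by near: M; exact: nbhs_infty_gt.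
  near: M; apply: filter_forall => x.
  exact: cvgr_gt (fine_cvg (prob_window_cvg x h0)) _ b1.
case=> M0 _ /(_ M0 (leqnn _)) [IM HM]; exists M0 => // x.
by rewrite sum_cell_prob // PoszD addrK ltW.
Unshelve. all: by end_near. Qed.

Lemma integral_sum_indic (J : finType) (A : pred J) (c : J -> R) (S : J -> set T) :
    (forall i, 0 <= c i) -> (forall i, measurable (S i)) ->
  (\int[P]_t (\sum_(i | A i) c i * \1_(S i) t)%:E
    = (\sum_(i | A i) c i * fine (P (S i)))%:E)%E.
Proof.
move=> c0 mS; under eq_integral do rewrite -sumEFin -big_filter.
rewrite ge0_integral_sum //=; last 2 first.
- by move=> i; apply/measurable_EFinP; apply: measurable_funM.
- by move=> i t _; rewrite lee_fin mulr_ge0.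
rewrite big_filter -sumEFin; apply: eq_bigr => i _.
under eq_integral do rewrite EFinM.
rewrite ge0_integralZl ?lee_fin //; last by apply/measurable_EFinP.
by rewrite integral_indic // setIT EFinM fineK // fin_num_measure.
Qed.

(** Letting the mass lost per site shrink like [1 / n] keeps the total loss within a factor [2],
    whatever the volume. *)
Lemma bernoulli_half : exists beta : R, [/\ 0 <= beta, beta < 1 & 2^-1 <= beta ^+ n].
Proof.
exists (1 - (2 * n.+1%:R)^-1); have n0 : 0 < n.+1%:R :> R by rewrite ltr0n.
have i0 : 0 < (2 * n.+1%:R)^-1 :> R by rewrite invr_gt0 mulr_gt0.
have i1 : (2 * n.+1%:R)^-1 <= 1 :> R by rewrite invf_le1 ?mulr_gt0 // -natrM ler1n.
have i2 : n%:R * (2 * n.+1%:R)^-1 <= 2^-1 :> R.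
  by rewrite ler_pdivrMr ?mulr_gt0 // mulrA mulVf // mul1r ler_nat.
move: (2 * _)^-1 i0 i1 i2 => y y0 y1 y2; split; [lra|lra|].
apply: le_trans (bernoulli_inequality n _); first by lra.
by rewrite y1 ltW.
Qed.

(** [F] abstracts the eigenvalue count. The simple function [Z] collects the block gains of the
    configurations lying on lines. Each configuration is met at most once per block, so [Z] is at
    most the sum of all block gains, which telescopes over the blocks; its expectation is bounded
    below block by block by [line_gain_ge]. *)
Lemma finite_volume_estimate (F : R -> ('I_n -> R) -> R) (p s : nat)
    (B : 'I_p -> {set 'I_n}) (E e delta h r : R) :
    (forall E1 E2 v w, (forall x, w x - E2 <= v x - E1) -> F E1 v <= F E2 w) ->
    (forall i j x, x \in B i -> x \in B j -> i = j) ->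
    (forall j, exists x, x \in B j) -> (forall j, #|B j| <= s)%N ->
    (forall j v w, (forall x, x \notin B j -> w x = v x) ->
       (forall x, x \in B j -> e + delta / 2 <= v x) ->
       (forall x, x \in B j -> w x <= e - delta / 2) -> F E v + 1 <= F E w) ->
    (forall K : 'I_n -> int,
       fine (P (cell_event h K)) = \prod_x cell_prob h x (K x)) ->
    (forall x (a : R), e - delta <= a -> a + h <= e + delta ->
       r * h <= fine (P (X x @^-1` `[a, a + h[%classic))) ->
    0 < h -> h <= delta / 8 -> 0 < r -> r * (delta / 4) <= 1 ->
  exists2 Z : T -> R, measurable_fun setT Z /\
    (forall t, 0 <= Z t <= F (E + 2 * h) (X^~ t) - F E (X^~ t)) &
    ((p%:R * (r * h * (r * (delta / 4)) ^+ s / 2))%:E <= \int[P]_t (Z t)%:E)%E.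
Proof.
move=> F_anti B_disj B_ex Bs cross indep q_ge h0 hd r0 k1.
have [T0 [I [tau [w1 w2 w3 w4 w5]]]] := grid_exists e h0 hd.
have [beta [b0 b1 bn]] := bernoulli_half.
have [M IM winM] := exists_window I h0 b1.
pose x0 j := xchoose (B_ex j); have x0B j : x0 j \in B j by exact: xchooseP.
have hge := ltW h0.
have FE_anti v w : (forall x, w x <= v x) -> F E v <= F E w.
  by move=> vw; apply: F_anti => x; rewrite lerD2r.
pose ln j (z : 'I_tau * {ffun 'I_n -> 'I_(M + M)}) := line B T0 M j z.1.+1 z.2.
pose base j (z : 'I_tau * {ffun 'I_n -> 'I_(M + M)}) := z.2 \in family (line_base B x0 I j).
pose gain j K := block_gain (F E) B h j K.
have gain0 j K : 0 <= gain j K by exact: block_gain_ge0.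
pose Z t := \sum_j \sum_(z | base j z) gain j (ln j z) * \1_(cell_event h (ln j z)) t.
have mZ j z : measurable (cell_event h (ln j z)) by exact: measurable_cell_event.
have mZj j : measurable_fun setT (fun t =>
    \sum_(z | base j z) gain j (ln j z) * \1_(cell_event h (ln j z)) t).
  under eq_fun do rewrite -big_filter.
  by apply: measurable_sum => z; exact: measurable_funM.
exists Z; first split.
- exact: measurable_sum.
- move=> t; rewrite sumr_ge0 /=; last by move=> j _; apply: sumr_ge0 => z _; rewrite mulr_ge0.
  pose K : {ffun 'I_n -> int} := [ffun x => Num.floor (X x t / h)].
  apply: (@le_trans _ _ (\sum_j gain j K)).
    apply: ler_sum => j _; under eq_bigr do rewrite indic_cell_event //.
    apply: (sum_indic_le (f := fun K : {ffun 'I_n -> int} => gain j K)) => // -[t1 u1] [t2 u2].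
    by move=> u1B u2B /(line_inj x0B u1B u2B) /= [/val_inj -> ->].
  have KX x : h * (K x)%:~R <= X x t < h * (K x + 1)%:~R.
    by have /(cellE (K x) (X x t) h0) : K x = Num.floor (X x t / h) by rewrite ffunE.
  (* Rounding down costs at most [h] and the lowering at most another [h], whence the energy step
     [2 * h]; for the other term, rounding down can only raise the count. *)
  rewrite sum_block_gain lerB //; apply: F_anti => x.
    have /andP[_ Xlt] := KX x; have := shifted_ge B hge p K x.
    move: Xlt; rewrite !intrD /= => Xlt.
    set S := shifted _ _ _ _ _; rewrite mulrBr => ?; lra.
  by rewrite lerD2r shifted0; have /andP[] := KX x.
apply: (@le_trans _ _ (\sum_j \sum_(z | base j z) gain j (ln j z) * 
    fine (P (cell_event h (ln j z))))%:E); last first.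
  under eq_integral do rewrite -sumEFin.
  rewrite ge0_integral_sum //=; last 2 first.
  - by move=> j; apply/measurable_EFinP.
  - by move=> j t _; rewrite lee_fin sumr_ge0 // => z _; rewrite mulr_ge0.
  by rewrite -sumEFin; apply: lee_sum => j _; rewrite integral_sum_indic.
rewrite lee_fin -[p in p%:R]card_ord -sum1_card natr_sum mulr_suml.
apply: ler_sum => j _; rewrite mul1r.
have kp : 0 <= r * (delta / 4) by rewrite mulr_ge0 ?ltW //; lra.
apply: (@le_trans _ _ (r * h * (r * (delta / 4)) ^+ s * beta ^+ n)).
  by rewrite ler_wpM2l // mulr_ge0 ?exprn_ge0 // mulr_ge0 ?ltW.
under eq_bigr do rewrite indep.
apply: line_gain_ge => //.
- by move=> x k; rewrite fine_ge0.
- move=> x k xB /andP[k1' k2].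
  have -> : cell_prob h x k = fine (P (X x @^-1` `[h * k%:~R, h * k%:~R + h[%classic)).
    by rewrite /cell_prob /cell intrD mulrDr mulr1.
  apply: q_ge.
  + by apply: le_trans w1 _; rewrite ler_pM2l // ler_int.
  + rewrite -{2}[h]mulr1 -mulrDr -(intrD _ k 1).
    by apply: le_trans w4; rewrite ler_pM2l // ler_int; clear -k2; lia.
- by clear -IM; lia.
- by rewrite mulr_ge0 // ltW.
- by rewrite -mulrA ler_wpM2l // ltW.
- exact: ltW.
- move=> u /familyP uB; apply: (cross j).
  + by move=> x /negPf xB; rewrite /shifted !ffunE xB.
  + move=> x xB; apply: le_trans w3 _; rewrite ler_pM2l // ler_int !ffunE xB.
    rewrite (_ : [exists _, _] = false); first by (clear; lia).
    by apply/existsP => -[i /andP[+ xi]]; rewrite (B_disj _ _ _ xi xB) ltnn.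
  + move=> x xB; apply: le_trans w2; rewrite ler_pM2l // ler_int !ffunE xB.
    have : (u x <= I)%N.
      move: (uB x); rewrite unfold_in /line_base xB.
      by case: eqP => // _ /eqP ->.
    rewrite (_ : [exists _, _] = false); first by move=> ux; rewrite subr0 addr0 lerD2l lez_nat.
    by apply/existsP => -[i /andP[+ xi]]; rewrite (B_disj _ _ _ xi xB) ltnn.
Qed.

End FiniteVolumeEstimate.

(** * Truncated plane waves on boxes *)

Section Boxes.
Variable d : nat.
Implicit Types (x y c : 'rV[int]_d) (L : {fset 'rV[int]_d}).

Definition box c (m : nat) x : bool := [forall k, c 0 k <= x 0 k < c 0 k + m%:Z].

Lemma boxP c m x : reflect (forall k, c 0 k <= x 0 k < c 0 k + m%:Z) (box c m x).
Proof. exact: forallP. Qed.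

Lemma site_inj L : injective (@site d L).
Proof. by move=> i j /val_inj /enum_val_inj. Qed.

Lemma site_in L (i : 'I_#|{: L}|) : site i \in L.
Proof. exact: valP. Qed.

Lemma site_surj L x : x \in L -> exists i : 'I_#|{: L}|, site i = x.
Proof. by move=> xL; exists (enum_rank [` xL]%fset); rewrite /site enum_rankK. Qed.

Lemma card_box L c m : (forall x, box c m x -> x \in L) ->
  #|[set i : 'I_#|{: L}| | box c m (site i)]%SET| = (m ^ d)%N.
Proof.
move=> cL; pose pt (g : {ffun 'I_d -> 'I_m}) : 'rV[int]_d := \row_k (c 0 k + (g k)%:Z).
have ptB g : box c m (pt g).
  by apply/boxP => k; rewrite mxE; have := ltn_ord (g k); lia.
pose f g := enum_rank [` cL _ (ptB g)]%fset.
have fE g : site (f g) = pt g by rewrite /site enum_rankK.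
have f_inj : injective f.
  move=> g g' /(congr1 (@site d L)); rewrite !fE => /rowP E; apply/ffunP => k.
  by apply: val_inj; have := E k; rewrite !mxE => /addrI [].
rewrite (_ : finset _ = f @: [set: {ffun 'I_d -> 'I_m}])%SET; last first.
  apply/setP => i; rewrite inE; apply/idP/imsetP => [/boxP ib|[g _ ->]]; last first.
    by rewrite fE.
  have lt k : (absz (site i 0 k - c 0 k)%R < m)%N by have := ib k; lia.
  exists [ffun k => Ordinal (lt k)]; rewrite ?inE //; apply: site_inj; rewrite fE.
  by apply/rowP => k; rewrite mxE ffunE /=; have := ib k; lia.
by rewrite card_imset // cardsT card_ffun !card_ord.
Qed.

Definition step (ks : 'I_d * bool) : 'rV[int]_d := (-1) ^+ ks.2 *: delta_mx 0 ks.1.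

Lemma stepE ks k : step ks 0 k = (-1) ^+ ks.2 * (k == ks.1)%:R.
Proof. by rewrite !mxE eqxx. Qed.

Lemma step_inj : injective step.
Proof.
move=> [k s] [k' s'] /rowP/(_ k); rewrite !stepE /= eqxx.
by case: eqP => [->|_]; case: s; case: s'.
Qed.

(** A sum of integer squares equals [1] only if one coordinate is [1] or [-1] and the others
    vanish. *)
Lemma adjE y x : adj y x = [exists ks, y == x + step ks].
Proof.
apply/eqP/existsP => [sum1|[ks /eqP ->]]; last first.
  rewrite (bigD1 ks.1) //= big1 => [|k /negPf kk].
    by rewrite !mxE !eqxx mulr1 addr0 addrAC subrr add0r sqrr_sign.
  by rewrite !mxE kk /= mulr0 addr0 subrr.
have [k uk] : exists k, y 0 k - x 0 k != 0.
  apply/existsP; apply: contra_eqT sum1 => /existsPn u0.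
  by rewrite big1 // => k _; move: (u0 k); rewrite negbK => /eqP ->.
move: sum1; rewrite (bigD1 k) //=; set S := \sum_(_ < _ | _) _ => sum1.
have S0 : 0 <= S by apply: sumr_ge0 => i _; exact: sqr_ge0.
have uk1 : (y 0 k - x 0 k) ^+ 2 = 1.
  have : 0 < (y 0 k - x 0 k) ^+ 2 by rewrite exprn_even_gt0 //= uk.
  by lia.
have : S = 0 by lia.
move/eqP; rewrite psumr_eq0 => [/allP u0|i _]; last exact: sqr_ge0.
have other i : i != k -> y 0 i = x 0 i.
  move=> ik; have := u0 i (mem_index_enum i); rewrite ik /= sqrf_eq0 subr_eq0.
  by move/eqP.
move/eqP: uk1; rewrite sqrf_eq1 => /orP[/eqP E|/eqP E].
  exists (k, false); apply/eqP/rowP => i; rewrite !mxE eqxx /= expr0 mul1r.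
  by have [->|/other ->] := eqVneq i k; rewrite ?addr0 // -E addrC subrK.
exists (k, true); apply/eqP/rowP => i; rewrite !mxE eqxx /= expr1 mulN1r.
by have [->|/other ->] := eqVneq i k; rewrite ?subr0 // -E addrC subrK.
Qed.

Lemma adj_sum (R : pzRingType) y x : (adj y x)%:R = \sum_ks (y == x + step ks)%:R :> R.
Proof.
rewrite adjE; case: existsP => [[ks /eqP ->]|no].
  rewrite (bigD1 ks) //= eqxx big1 ?addr0 // => ks' ne.
  by rewrite (inj_eq (addrI x)) (inj_eq step_inj) eq_sym (negPf ne).
by rewrite big1 // => ks _; case: eqP => // E; case: no; exists ks; apply/eqP.
Qed.

Lemma adj_sym y x : adj y x = adj x y.
Proof. by rewrite /adj; congr (_ == _); apply: eq_bigr => k _; rewrite -sqrrN opprB. Qed.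

End Boxes.

Section TestFunction.
Local Open Scope complex_scope.
Variables (R : realType) (d : nat) (L : {fset 'rV[int]_d}) (c : 'rV[int]_d) (b : nat).
Local Notation C := R[i].
Hypothesis boxL : forall x, box c b.+4 x -> x \in L.
Variables (z : C).
Hypothesis z1 : `|z| = 1.

(** Nested boxes, each one layer inside the previous one: neighbours of [inner1] stay in the block,
    and neighbours of [inner2] stay in [inner1], where the plane wave is not cut off. *)
Let inner1 := box (c + const_mx 1) b.+2.
Let inner2 := box (c + const_mx 2) b.

(* Each of the [2 d] neighbours of a site contributes a factor [z] or [z^-1], so
   the plane wave has energy [d (z + z^-1)] except near the faces of the box; it
   is cut off one layer inside, so that the residual still lives in the box and
   never sees the boundary term of the Dirichlet Laplacian. *)
Definition wave (x : 'rV[int]_d) : C := if inner1 x then z ^ (\sum_k x 0 k) else 0.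

Definition wave_row : 'rV[C]_#|{: L}| := \row_i wave (site i).

Definition wave_energy : C := d%:R * (z + z^-1).

Let z_neq0 : z != 0. Proof. by rewrite -normr_gt0 z1. Qed.

Let normz m : `|z ^ m| = 1.
Proof.
case: m => m; rewrite ?NegzE -?exprnN -?exprnP ?normrV ?unitfE ?expf_neq0 //;
  by rewrite normrX z1 expr1n ?invr1.
Qed.

Lemma inner1_step x ks : inner1 (x + step ks) -> box c b.+4 x.
Proof.
case: ks => k' [] /boxP H; apply/boxP => k; have := H k; rewrite !mxE eqxx /=.
  by case: eqP => _; lia.
by case: eqP => _; lia.
Qed.

Lemma inner1_box x : inner1 x -> box c b.+4 x.
Proof. by move=> /boxP H; apply/boxP => k; have := H k; rewrite !mxE /=; lia. Qed.

Lemma inner2_box x : inner2 x -> box c b.+4 x.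
Proof. by move=> /boxP H; apply/boxP => k; have := H k; rewrite !mxE /=; lia. Qed.

Lemma inner2_step x ks : inner2 x -> inner1 (x + step ks).
Proof.
case: ks => k' [] /boxP H; apply/boxP => k; have := H k; rewrite !mxE eqxx /=.
  by case: eqP => _; lia.
by case: eqP => _; lia.
Qed.

Lemma inner1_stepbox x ks : inner1 x -> box c b.+4 (x + step ks).
Proof.
case: ks => k' [] /boxP H; apply/boxP => k; have := H k; rewrite !mxE eqxx /=.
  by case: eqP => _; lia.
by case: eqP => _; lia.
Qed.

Lemma inner2_inner1 x : inner2 x -> inner1 x.
Proof. by move=> /boxP H; apply/boxP => k; have := H k; rewrite !mxE /=; lia. Qed.

Lemma boundary_degree_inner x : inner1 x -> boundary_degree L x = 0%N.
Proof.
move=> x1; rewrite /boundary_degree (_ : [set _ | _] = set0) ?fset_set0 ?cardfs0 //.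
rewrite -subset0 => y [yL]; rewrite adj_sym adjE => /existsP[ks /eqP yE].
by case/negP: yL; rewrite yE; apply/boxL/inner1_stepbox.
Qed.

Lemma sum_wave_adj x :
  \sum_j wave_row 0 j * (adj (site j) x)%:R = \sum_ks wave (x + step ks).
Proof.
under eq_bigr do rewrite adj_sum mulr_sumr.
rewrite exchange_big; apply: eq_bigr => ks _ /=.
have [xL|xL] := boolP (x + step ks \in L).
  have [j jE] := site_surj xL; rewrite (bigD1 j) //= big1 => [|j' j'j].
    by rewrite addr0 mxE -jE eqxx mulr1.
  by rewrite -jE (inj_eq (@site_inj _ L)) (negPf j'j) mulr0.
rewrite /wave ifN; last by apply: contra xL => /inner1_box/boxL.
rewrite big1 // => j _; case: eqP => [E|_]; last by rewrite mulr0.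
by move: xL; rewrite -E site_in.
Qed.

(** The diagonal boundary term drops out: where the wave is nonzero, all neighbours lie in [L]. *)
Lemma wave_residual i :
  (wave_row *m (dirichlet_laplacian R L - wave_energy%:M)) 0 i
    = \sum_ks wave (site i + step ks) - wave_energy * wave (site i).
Proof.
rewrite mulmxBr mul_mx_scalar !mxE; congr (_ - _); rewrite -sum_wave_adj.
apply: eq_bigr => j _; rewrite !mxE mulrDr -[RHS]addr0; congr (_ + _).
rewrite /wave; case: ifP => [x1|]; last by rewrite mul0r.
by rewrite boundary_degree_inner // mul0rn mulr0.
Qed.

Lemma wave_row_out i : ~~ box c b.+4 (site i) -> wave_row 0 i = 0.
Proof. by move=> iB; rewrite mxE /wave ifN //; apply: contra iB; exact: inner1_box. Qed.

Lemma wave_residual_out i : ~~ box c b.+4 (site i) ->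
  (wave_row *m (dirichlet_laplacian R L - wave_energy%:M)) 0 i = 0.
Proof.
move=> iB; rewrite wave_residual; have := wave_row_out iB; rewrite mxE => ->.
rewrite mulr0 subr0 big1 // => ks _; rewrite /wave ifN //.
by apply: contra iB; exact: inner1_step.
Qed.

Lemma wave_residual_inner i : inner2 (site i) ->
  (wave_row *m (dirichlet_laplacian R L - wave_energy%:M)) 0 i = 0.
Proof.
move=> i2; rewrite wave_residual {2}/wave inner2_inner1 //.
apply/eqP; rewrite subr_eq0; apply/eqP.
have sum_step ks : \sum_k step ks 0 k = (-1) ^+ ks.2.
  rewrite (bigD1 ks.1) //= big1 => [|k /negPf kk]; first by rewrite stepE eqxx mulr1 addr0.
  by rewrite stepE kk mulr0.
transitivity (\sum_(ks : 'I_d * bool) z ^ ((-1) ^+ ks.2) * z ^ (\sum_k site i 0 k)).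
  apply: eq_bigr => ks _; rewrite /wave inner2_step //.
  rewrite -expfzDr // -sum_step -big_split /= addrC; congr (z ^ _).
  by apply: eq_bigr => k _; rewrite mxE.
rewrite -mulr_suml; congr (_ * _).
rewrite -(pair_big xpredT xpredT (fun (k : 'I_d) (s : bool) => z ^ ((-1) ^+ s))) /=.
under eq_bigr do rewrite big_bool /=.
by rewrite sumr_const card_ord -mulr_natl expr1z exprN1 addrC.
Qed.

Lemma wave_norm_le x : `|wave x| <= 1.
Proof. by rewrite /wave; case: ifP => _; rewrite ?normz // normr0. Qed.

Lemma wave_residual_norm i :
  `|(wave_row *m (dirichlet_laplacian R L - wave_energy%:M)) 0 i| ^+ 2 <= 16 * d%:R ^+ 2.
Proof.
rewrite wave_residual (_ : 16 * d%:R ^+ 2 = (4 * d%:R) ^+ 2 :> C); last by ring.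
rewrite lerXn2r ?nnegrE ?mulr_ge0 //.
apply: le_trans (ler_normB _ _) _; rewrite (_ : 4 * d%:R = 2 * d%:R + 2 * d%:R :> C); last by ring.
apply: lerD.
  apply: le_trans (ler_norm_sum _ _ _) _.
  apply: le_trans (ler_sum _ (fun ks _ => wave_norm_le _)) _.
  by rewrite sumr_const card_prod card_ord card_bool natrM mulrC.
rewrite normrM -[leRHS]mulr1 ler_pM // ?wave_norm_le //.
rewrite /wave_energy normrM normr_nat mulrC ler_wpM2r //.
by apply: le_trans (ler_normD _ _) _; rewrite normfV z1 invr1.
Qed.

Lemma sum_wave_row_norm : \sum_i `|wave_row 0 i| ^+ 2 = (b.+2 ^ d)%:R.
Proof.
rewrite -(@card_box _ L (c + const_mx 1)) => [|x x1]; last exact/boxL/inner1_box.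
rewrite -sum1_card natr_sum [RHS]big_mkcond /=; apply: eq_bigr => i _.
rewrite mxE /wave inE -/inner1; case: ifP => _; rewrite ?normz ?expr1n //.
by rewrite normr0 expr0n.
Qed.

(** The residual lives on the shell between [inner2] and the block, and is at most [4 * d] there:
    [2 * d] neighbours of modulus at most [1], and an energy of modulus at most [2 * d]. *)
Lemma sum_wave_residual :
  \sum_i `|(wave_row *m (dirichlet_laplacian R L - wave_energy%:M)) 0 i| ^+ 2
    <= 16 * d%:R ^+ 2 * ((b.+4 ^ d)%:R - (b ^ d)%:R).
Proof.
rewrite -(card_box boxL) -(@card_box _ L (c + const_mx 2)) => [|x x2]; last first.
  exact/boxL/inner2_box.
set S := [set _ | _]%SET; set S2 := [set _ | _]%SET.
have S2S : S2 \subset S by apply/fintype.subsetP => i; rewrite !inE; exact: inner2_box.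
rewrite -natrB ?subset_leq_card // -cardsDS // mulr_natr -sumr_const.
rewrite [leRHS]big_mkcond /=; apply: ler_sum => i _; rewrite !inE.
have [i2|i2] /= := boolP (box (c + const_mx 2) b (site i)).
  by rewrite wave_residual_inner // normr0 expr0n.
have [iB|iB] := boolP (box c b.+4 (site i)); first exact: wave_residual_norm.
by rewrite wave_residual_out // normr0 expr0n.
Qed.

End TestFunction.

(** * Limits of expectations and densities *)

Section ProbabilityTools.
Context {d0 : measure_display} {T : measurableType d0} {R : realType}.
Variable P : probability T R.

Lemma ess_inf_itv_gt0 (rho : R -> R) (a b : R) : (0 < ess_inf_itv rho a b)%E ->
  exists2 r : R, 0 < r &
    forall s, s <= r -> {ae (@lebesgue_measure R), forall w, a <= w <= b -> s <= rho w}.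
Proof.
move=> inf0.
have [r r0 rinf] : exists2 r : R, 0 < r & (r%:E <= ess_inf_itv rho a b)%E.
  case: (ess_inf_itv rho a b) inf0 => [x| |] //; first by rewrite lte_fin; exists x.
  (* If the essential infimum is infinite, any positive number will do. *)
  by exists 1; rewrite ?leey.
exists r => // s sr.
have /ess_infP[S [mS S0 sub]] : (s%:E <= ess_inf_itv rho a b)%E.
  by apply: le_trans rinf; rewrite lee_fin.
exists (S `&` `[a, b]%classic); split => //.
  by apply: measurableI => //; exact: measurable_itv.
move=> w /= /not_implyP[wab nle]; split; last by rewrite /= in_itv.
by apply: sub => /=; rewrite lee_fin.
Qed.

Lemma density_prob_ge (X : {RV P >-> R}) (rho : R -> R) (r a b u h : R) :
    has_density X rho -> 0 <= r ->
    {ae (@lebesgue_measure R), forall w, a <= w <= b -> r <= rho w} ->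
    0 <= h -> a <= u -> u + h <= b ->
  r * h <= fine (P (X @^-1` `[u, u + h[%classic)).
Proof.
move=> [mrho rho0 distE] r0 rho_ge h0 au uhb.
have mI : measurable (`[u, u + h[%classic : set R) by exact: measurable_itv.
rewrite -lee_fin fineK; last first.
  by rewrite fin_num_measure // -[_ @^-1` _]setTI; exact: (measurable_funP X).
have -> : P (X @^-1` `[u, u + h[%classic) = distribution P X `[u, u + h[%classic by [].
rewrite distE // (_ : (r * h)%:E =
    (\int[lebesgue_measure]_(w in `[u, (u + h)%R[) (cst r%:E w))%E); last first.
  rewrite integral_cst //= lebesgue_measure_itv /= lte_fin.
  case: ltP => [_|uh]; first by rewrite -EFinD addrAC subrr add0r EFinM.
  by rewrite (_ : h = 0) ?mulr0 ?mule0 //; lra.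
apply: ae_ge0_le_integral => //.
- by move=> w _; rewrite lee_fin.
- by apply/measurable_EFinP; exact: measurable_funS mrho.
case: rho_ge => S [mS S0 sub]; exists S; split => // w /= /not_implyP[wI nle].
apply: sub => /= H; apply: nle; rewrite lee_fin; apply: H.
by move: wI; rewrite in_itv /= => /andP[? ?]; lra.
Qed.

(* [Y] itself is not assumed measurable: eigenvalue counts are only compared with
   the simple functions [Z]. *)
Lemma limit_expectation_ge (Y Z : nat -> T -> R) (x c : R) (K : nat) :
    (forall k, measurable_fun setT (Z k)) ->
    (forall k t, 0 <= Z k t <= Y k t) -> (forall k t, Y k t <= 1) ->
    {ae P, forall t, (Y ^~ t) @ \oo --> x} -> 0 <= x ->
    (forall k, (K <= k)%N -> (c%:E <= \int[P]_t (Z k t)%:E)%E) ->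
  c <= x.
Proof.
move=> mZ ZY Y1 Yx x0 cZ.
(* The positive part of [Z k - x] is at most [1] and at most the distance of [Y k] to [x], so its
   expectation tends to [0], while [Z k <= x + W k]. *)
pose W k t : \bar R := (Num.max (Z k t - x) 0)%:E.
have mW k : measurable_fun setT (W k).
  apply/measurable_EFinP; apply: measurable_maxr => //.
  by apply: measurable_funB.
have W0 k t : (0 <= W k t)%E by rewrite lee_fin le_max lexx orbT.
have [] := @dominated_convergence _ _ _ P setT measurableT W (cst 0%E) (cst 1%E) mW.
- exact: measurable_cst.
- case: Yx => S [mS S0 sub]; exists S; split => //; apply: subset_trans sub.
  apply: subsetC => t /= Yt _; apply: cvg_EFin; first by apply: nearW.
  apply: (@squeeze_cvgr _ _ _ _ (cst 0) (fun k => `|Y k t - x|)).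
  + apply: nearW => k /=; rewrite le_max lexx orbT /= ge_max normr_ge0 andbT.
    have /andP[_ ZYk] := ZY k t; have := ler_norm (Y k t - x); lra.
  + exact: cvg_cst.
  + by rewrite -(@normr0 _ R) -(subrr x); apply: cvg_norm; apply: cvgB => //; exact: cvg_cst.
- by apply: finite_measure_integrable_cst.
- apply: aeW => t k _; rewrite gee0_abs // lee_fin ge_max ler01 andbT.
  have /andP[_ ZYk] := ZY k t; have := Y1 k t; lra.
move=> _ _; rewrite integral0 => /fine_cvgP[_ W_cvg].
apply/ler_addgt0Pr => e e0.
have [k [Kk Wk]] : exists k, (K <= k)%N /\ fine (\int[P]_t W k t)%E < e.
  near \oo => k; exists k; split; first by near: k; exact: nbhs_infty_ge.
  near: k; exact: cvgr_lt W_cvg _ e0.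
have Wfin : (\int[P]_t W k t)%E \is a fin_num.
  rewrite ge0_fin_numE ?integral_ge0 //; apply: (@le_lt_trans _ _ (\int[P]_t (cst 1%E t))%E).
    apply: ge0_le_integral => // t _; rewrite lee_fin ge_max ler01 andbT.
    have /andP[_ ZYk] := ZY k t; have := Y1 k t; lra.
  by rewrite integral_cst //= probability_setT mul1e ltry.
rewrite -lee_fin; apply: (le_trans (cZ k Kk)).
apply: (@le_trans _ _ (\int[P]_t (cst x%:E t + W k t))%E).
  apply: ge0_le_integral => //.
  - by move=> t _; rewrite lee_fin; have /andP[] := ZY k t.
  - exact/measurable_EFinP.
  - by apply: emeasurable_funD => //; exact: measurable_cst.
  - move=> t _; rewrite -EFinD lee_fin -lerBlDl le_max lexx //.
rewrite ge0_integralD //.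
rewrite integral_cst //= probability_setT mule1 EFinD leeD2l // -(fineK Wfin).
by rewrite lee_fin ltW.
Unshelve. all: by end_near. Qed.

Lemma indep_cell_event (d : nat) (omega : 'rV[int]_d -> {RV P >-> R})
    (L : {fset 'rV[int]_d}) (h : R) (K : 'I_#|{: L}| -> int) :
  mutually_independent omega ->
  fine (P (cell_event (fun i => omega (site i)) h K))
    = \prod_i cell_prob (fun i => omega (site i)) h i (K i).
Proof.
move=> indep; pose K' x := if [pick i | site i == x] is Some i then K i else 0.
have K'E i : K' (site i) = K i.
  rewrite /K'; case: pickP => [j /eqP /site_inj -> //|/(_ i)]; by rewrite eqxx.
have mc x : measurable (cell h (K' x)) by exact: measurable_itv.
have -> : cell_event (fun i => omega (site i)) h K
    = \bigcap_(x in [set` L]) (omega x @^-1` cell h (K' x)).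
  apply/seteqP; split => t Ht.
    by move=> x /= /site_surj[i <-]; rewrite /= K'E; exact: Ht.
  by move=> i _; have := Ht _ (site_in i); rewrite /= K'E.
rewrite indep // big_seq_fsetE /=.
rewrite (reindex (enum_val : 'I_#|{: L}| -> _)) /=; last first.
  by exists enum_rank => x _; rewrite ?enum_valK ?enum_rankK.
rewrite (eq_bigr (fun i => (cell_prob (fun i => omega (site i)) h i (K i))%:E)).
  by rewrite prodEFin.
move=> i _; rewrite /cell_prob fineK -?K'E //.
by rewrite fin_num_measure // -[_ @^-1` _]setTI; exact: (measurable_funP (omega (site i))).
Qed.

End ProbabilityTools.

(** * Almost everywhere differentiability of absolutely continuous monotone functions *)

Section AbsolutelyContinuous.
Variables (R : realType) (N : R -> R).
Hypothesis N_nd : {homo N : x y / x <= y}.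
Hypothesis N_ac : abs_continuous N.
Local Notation mu := (@lebesgue_measure R).

Lemma abs_continuous_continuous : continuous N.
Proof.
move=> x; apply/cvgrPdist_lt => e e0.
have x1 : x - 1 <= x + 1 by lra.
have [h h0 H] := N_ac x1 e0.
near=> y.
have yx : `|x - y| < Num.min 1 h.
  by near: y; apply: (@cvgr_dist_lt _ _ _ (nbhs x) _ id x) => //; rewrite lt_min ltr01.
move: yx; rewrite lt_min => /andP[y1 yh].
have := H 1%N (fun=> Num.min x y) (fun=> Num.max x y).
rewrite !big_ord1; have [xy|yx] := leP x y.
  rewrite distrC; apply => [_||].
  - by move: y1; rewrite ltr_distl => /andP[? ?]; split => //; lra.
  - by move=> i j _ _ _; rewrite !ord1.
  - by move: yh; rewrite distrC ger0_norm ?subr_ge0.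
apply => [_||].
- by move: y1; rewrite ltr_distl => /andP[? ?]; split; lra.
- by move=> i j _ _ _; rewrite !ord1.
- by move: yh; rewrite gtr0_norm ?subr_gt0.
Unshelve. all: by end_near. Qed.

Let N_rc : right_continuous N.
Proof. exact/right_continuousW/abs_continuous_continuous. Qed.

Let Nc : cumulative R R := HB.pack N (isCumulative.Build _ _ _ N N_nd N_rc).

Let ls := lebesgue_stieltjes_measure Nc.

Lemma ls_itv a b : a <= b -> ls `]a, b]%classic = (N b - N a)%:E.
Proof.
move=> ab; rewrite /ls /lebesgue_stieltjes_measure /measure_extension.
by rewrite measurable_mu_extE /=; [exact: wlength_itv_bnd|exact: is_ocitv].
Qed.

Lemma open_interval_bounded (I : set R) (a b : R) : a <= b -> open I -> is_interval I ->
  I `<=` `]a, b[ -> exists u v, [/\ a <= u, u <= v, v <= b & I = `]u, v[%classic].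
Proof.
move=> ab oI iI Iab; have [->|/set0P[x Ix]] := eqVneq I set0.
  by exists a, a; split => //; rewrite set_itvoo0.
have ubI : ubound I b by move=> y /Iab /=; rewrite in_itv /= => /andP[_ /ltW].
have lbI : lbound I a by move=> y /Iab /=; rewrite in_itv /= => /andP[/ltW].
have hl : has_lbound I by exists a.
have hu : has_ubound I by exists b.
exists (inf I), (sup I); split.
- by apply: lb_le_inf => //; exists x.
- by apply: (@le_trans _ _ x); [exact: inf_lbound|exact: sup_ubound].
- by apply: ge_sup => //; exists x.
- rewrite -{1}(interior_id I).1 // interval_bounded_interior //.
Qed.

(** By outer regularity [A] lies in an open subset [V] of []a, b[] whose Lebesgue measure is below
    the threshold of absolute continuity for [e]. The components of [V] are disjoint intervals;
    every finite sum of increments of [N] over them is below [e], hence [ls V] is at most [e]. *)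
Lemma ls_dominates (a b : R) (ab : a < b) (A : set R) : measurable A -> mu A = 0%E ->
  A `<=` `]a, b[ -> ls A = 0%E.
Proof.
move=> mA A0 Aab; apply/eqP; rewrite eq_le measure_ge0 andbT.
apply/lee_addgt0Pr => e e0; rewrite add0e.
have [h h0 H] := N_ac (ltW ab) e0.
have [|U [oU AU UA]] := lebesgue_regularity_outer mA _ h0; first by rewrite [X in (X < _)%E]A0.
pose V := U `&` `]a, b[.
have oV : open V by apply: openI => //; exact: interval_open.
have AV : A `<=` V by move=> x Ax; split; [exact: AU|exact: Aab].
have muV : (mu V < h%:E)%E.
  apply: le_lt_trans UA; rewrite -[leRHS]adde0 -[X in (_ + X)%E]A0.
  rewrite -measureU //; last 2 first.
  - by apply: measurableD => //; exact: open_measurable.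
  - by rewrite setDE -setIA setICl setI0.
  apply: le_measure; rewrite ?inE; [exact: open_measurable| |].
    by apply: measurableU => //; apply: measurableD => //; exact: open_measurable.
  by move=> x [Ux _]; have [Ax|nAx] := pselect (A x); [right|left].
pose I := open_disjoint_itv oV.
have tI : trivIset setT I by exact: open_disjoint_itv_trivIset.
have VE : V = \bigcup_q I q by exact: open_disjoint_itv_bigcup.
have mI i : measurable (I i) by apply: open_measurable; exact: open_disjoint_itv_open.
have Iuv i : exists uv : R * R, [/\ a <= uv.1, uv.1 <= uv.2, uv.2 <= b
     & I i = `]uv.1, uv.2[%classic].
  have [|u [v uvP]] := @open_interval_bounded (I i) a b (ltW ab)
    (@open_disjoint_itv_open _ _ oV i) (@open_disjoint_itv_is_interval _ _ oV i).
    by move=> x Ix; have [] : V x by rewrite VE; exists i.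
  by exists (u, v).
have [uv uvP] := choice Iuv.
apply: (@le_trans _ _ (ls V)).
  by apply: le_measure; rewrite ?inE //; exact: open_measurable.
rewrite /ls VE measure_semi_bigcup //; last by rewrite -VE; exact: open_measurable.
apply: lime_le; first exact: is_cvg_nneseries.
near=> n; rewrite big_mkord.
apply: (@le_trans _ _ (\sum_(i < n) (N (uv i).2 - N (uv i).1)%:E)%E).
  apply: lee_sum => i _; have [_ le_uv _ ->] := uvP i; rewrite -ls_itv //.
  apply: le_measure; rewrite ?inE; [exact: measurable_itv|exact: measurable_itv|].
  by apply: subset_itvl; rewrite bnd_simp.
rewrite sumEFin lee_fin; apply/ltW/le_lt_trans/(H n (fun i => (uv i).1) (fun i => (uv i).2)).
- by apply: ler_sum => i _; exact: ler_norm.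
- by move=> i; have [] := uvP i.
- move=> i j _ _; have [_ _ _ <-] := uvP i; have [_ _ _ <-] := uvP j.
  by move=> ij; apply/val_inj/tI.
- rewrite -lte_fin; apply: le_lt_trans muV.
  rewrite -sumEFin (eq_bigr (fun i : 'I_n => mu (I i))); last first.
    move=> i _; have [_ le_uv _ ->] := uvP i.
    rewrite lebesgue_measure_itv /= lte_fin; case: ltP => //.
    move=> vu; have /eqP -> : (uv i).2 == (uv i).1 by rewrite eq_le vu.
    by rewrite subrr.
  rewrite -(big_mkord xpredT (fun i => mu (I i))) VE measure_semi_bigcup //; last first.
    by rewrite -VE; exact: open_measurable.
  exact: nneseries_lim_ge.
Unshelve. all: by end_near. Qed.

(** Restricting to a bounded interval makes the Stieltjes measure finite. Its Radon-Nikodym density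
    [g] is integrable, and there [N] is the indefinite integral of [g] plus the constant [N (- M)],
    so the Lebesgue differentiation theorem applies. *)
Lemma ae_derivable (M : R) :
  {ae mu, forall x, - M < x < M -> derivable N x 1}.
Proof.
have [M0|M0] := leP M 0; first by apply: aeW => x; lra.
have MM : - M < M by lra.
pose D : set R := `]- M, M[%classic.
have mD : measurable D by exact: measurable_itv.
have DE : (ls D < +oo)%E.
  apply: (@le_lt_trans _ _ (ls `]- M, M]%classic)); last by rewrite ls_itv ?ltry // ltW.
  apply: le_measure; rewrite ?inE //.
  by apply: subset_itvl; rewrite bnd_simp.
pose nu : {finite_measure set (measurableTypeR R) -> \bar R} :=
  @mfrestr _ (measurableTypeR R) R D (lebesgue_stieltjes_measure Nc) mD DE.
have nu_mu : nu `<< mu.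
  apply/null_content_dominatesP => A mA A0.
  rewrite /nu /mfrestr /mrestr; apply: (ls_dominates MM); first exact: measurableI.
    apply/eqP; rewrite eq_le measure_ge0 andbT -A0.
    by apply: le_measure; rewrite ?inE //; exact: measurableI.
  by move=> x [].
have [f [f0 ffin intf nuE]] := radon_nikodym_sigma_finite nu_mu.
pose g := fine \o f.
have fg : f = EFin \o g by apply/funext => x; rewrite /g /= fineK.
have intg : mu.-integrable setT (EFin \o g) by rewrite -fg.
have locg : locally_integrable setT g by apply: open_integrable_locally => //; exact: openT.
have intgy y : mu.-integrable [set` Interval (BRight (- M)) (BRight y)] (EFin \o g).
  by apply: integrableS intg => //; exact: measurable_itv.
have := FTC1 intgy locg.
apply: filterS; first exact: (ae_filter_ringOfSetsType mu).
move=> x H /andP[Mx xM]; have ltx : (BRight (- M) < BRight x)%O by rewrite bnd_simp.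
have [dF _] := H ltx.
suff : derivable (fun y => (\int[mu]_(t in `]- M, y]) g t)%R + N (- M)) x 1.
  apply: near_eq_derivable; near=> y.
  have My : - M < y by near: y; exact: lt_nbhsr.
  have yM : y < M by near: y; exact: lt_nbhsl.
  rewrite /Rintegral.
  have -> : (\int[mu]_(t in `](- M)%R, y]) (g t)%:E)%E = nu `]- M, y]%classic.
    rewrite nuE; last exact: measurable_itv.
    by rewrite fg.
  rewrite /nu /= /mfrestr /mrestr setIidl; last first.
    by move=> z /=; rewrite /D /= !in_itv /= => /andP[-> /le_lt_trans]; exact.
  by rewrite -/ls ls_itv ?subrK /= ?subrK // ltW.
exact: derivableD.
Unshelve. all: by end_near. Qed.

End AbsolutelyContinuous.

(** * Eigenvalue counts of the Dirichlet Hamiltonian on a cube *)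

Section SiteCount.
Local Open Scope complex_scope.
Variables (R : realType) (d : nat) (L : {fset 'rV[int]_d}).

Definition site_count (E : R) (w : 'I_#|{: L}| -> R) : R :=
  (eig_le (dirichlet_laplacian R L + diag_mx (\row_i (w i)%:C)) E%:C)%:R.

Lemma dirichlet_laplacian_herm : dirichlet_laplacian R L \is hermsymmx.
Proof.
apply/is_hermitianmxP; rewrite expr0 scale1r; apply/matrixP => i j; rewrite !mxE.
rewrite [RHS]rmorphD /= [X in _ = _ + X]rmorphMn /= !rmorph_nat adj_sym eq_sym.
by congr (_ + _); case: eqP => // ->.
Qed.

Lemma real_row (w : 'I_#|{: L}| -> R) : \row_i (w i)%:C \is a mxOver (@Num.real R[i]).
Proof. by apply/mxOverP => i j; rewrite mxE complex_real. Qed.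

Lemma real_cplx (x : R) : x%:C \is @Num.real R[i].
Proof. by rewrite complex_real. Qed.

(** The trace is invariant under the unitary conjugation, which leaves a sum of indicators of
    eigenvalues; these are real, so the order of [R[i]] agrees with that of their real parts. *)
Lemma spectral_traceE (v : 'rV[int]_d -> R) E :
  spectral_trace L v E = site_count E (fun i => v (site i)).
Proof.
rewrite /spectral_trace /hermitian_calculus.
have hH : dirichlet_hamiltonian L v \is hermsymmx.
  by apply: hermsymmx_diag; [exact: dirichlet_laplacian_herm|exact: real_row].
rewrite mxtrace_mulC mulmxA mulmxV ?spectral_unit // mul1mx mxtrace_diag.
rewrite raddf_sum /= /site_count /eig_le -sum1_card natr_sum [RHS]big_mkcond /=.
apply: eq_bigr => i _; rewrite !mxE /= inE indicE.
have := hermitian_spectral_diag_real hH; rewrite -/(potential L v) -/(dirichlet_hamiltonian L v).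
move=> /mxOverP/(_ 0 i); case: (spectral_diag _ 0 i) => x y; rewrite complex_real => /eqP ->.
rewrite lecE /= eqxx /=.
by case: (boolP (x <= E)) => H; [rewrite mem_set|rewrite memNset] => //=;
  rewrite in_itv //=; apply/negP.
Qed.

Lemma site_count_anti (E1 E2 : R) v w :
  (forall x, w x - E2 <= v x - E1) -> site_count E1 v <= site_count E2 w.
Proof.
move=> vw; rewrite ler_nat; apply: eig_le_diag; rewrite ?real_row ?real_cplx //.
  exact: dirichlet_laplacian_herm.
by move=> i; rewrite !mxE -!rmorphB /= lecR.
Qed.

Lemma site_count_ge0 E w : 0 <= site_count E w.
Proof. exact: ler0n. Qed.

Lemma site_count_le E w : site_count E w <= #|` L|%:R.
Proof. by rewrite ler_nat cardfE eig_le_max. Qed.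

End SiteCount.

(** [z] is the point of the unit circle with real part [g / 2], and its inverse is its conjugate.
    Hence plane waves reach every energy of [[-2d, 2d]]. *)
Lemma exists_unit_complex (R : realType) (g : R) : `|g| <= 2 ->
  exists2 z : R[i]%C, `|z| = 1 & z + z^-1 = (g%:C)%C.
Proof.
move=> g2; pose s := Num.sqrt (1 - (g / 2) ^+ 2).
have s2 : s ^+ 2 = 1 - (g / 2) ^+ 2.
  rewrite sqr_sqrtr // (_ : 1 - _ = (1 - g / 2) * (1 + g / 2)); last by ring.
  by move: g2; rewrite ler_norml => /andP[? ?]; apply: mulr_ge0; lra.
pose z : R[i]%C := (g / 2 +i* s)%C.
have z1 : `|z| = 1 by rewrite normc_def /= s2 addrC subrK sqrtr1.
exists z => //; have -> : z^-1 = (g / 2 +i* - s)%C.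
  have z0 : z != 0 by rewrite -normr_gt0 z1.
  apply: (mulfI z0); rewrite mulfV //; apply/eqP; rewrite eq_complex /=.
  by apply/andP; split; apply/eqP; [rewrite mulrN opprK -!expr2 s2; ring|ring].
by apply/eqP; rewrite eq_complex /= addrN eqxx andbT; apply/eqP; lra.
Qed.

Lemma exists_side (R : realType) (d : nat) (eta : R) : 0 < eta ->
  exists b : nat, 16 * d%:R ^+ 2 * ((b.+4 ^ d)%:R - (b ^ d)%:R) <= eta ^+ 2 * (b.+2 ^ d)%:R.
Proof.
move=> eta0; have e2 : 0 < eta ^+ 2 by rewrite exprn_gt0.
(* By Bernoulli's inequality the shell has at most the fraction [4 * d / b.+4] of the big box, and
   the middle box at least [1 - 2 * d / b.+4] of it; [b > x] is what the comparison then
   requires. *)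
pose x := (64 * d%:R ^+ 3 + 2 * d%:R * eta ^+ 2) / eta ^+ 2.
exists (Num.bound x); set b := Num.bound x.
have x0 : 0 <= x by rewrite divr_ge0 ?addr_ge0 ?mulr_ge0 ?exprn_ge0 // ltW.
have : x < b%:R by exact: archi_boundP.
rewrite ltr_pdivrMr // => xb.
have B0 : 0 < b.+4%:R :> R by rewrite ltr0n.
have bern (k : nat) : (k <= 4)%N ->
    (b.+4 ^ d)%:R * (1 - d%:R * (k%:R / b.+4%:R)) <= ((b.+4 - k) ^ d)%:R :> R.
  move=> k4; rewrite !natrX natrB; last by rewrite (leq_trans k4).
  rewrite [X in _ <= X ^+ _](_ : _ = b.+4%:R * (1 - k%:R / b.+4%:R)); last first.
    by field; lra.
  rewrite exprMn ler_wpM2l ?exprn_ge0 //; apply: bernoulli_inequality.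
  by rewrite divr_ge0 //= ler_pdivrMr // mul1r ler_nat (leq_trans k4).
have b4 := bern 4 isT; have b2 := bern 2 isT.
have -> : (b = b.+4 - 4)%N by lia.
have -> : ((b.+4 - 4).+2 = b.+4 - 2)%N by lia.
have -> : ((b.+4 - 4).+4 = b.+4)%N by lia.
set S := (b.+4 ^ d)%:R in b4 b2 *.
have S0 : 0 <= S by [].
apply: (@le_trans _ _ (16 * d%:R ^+ 2 * (S * (d%:R * (4 / b.+4%:R))))).
  by rewrite ler_wpM2l ?mulr_ge0 ?exprn_ge0 // lerBlDr -lerBlDl -{1}[S]mulr1 -mulrBr.
apply: (@le_trans _ _ (eta ^+ 2 * (S * (1 - d%:R * (2 / b.+4%:R))))); last first.
  by rewrite ler_wpM2l // ltW.
rewrite -subr_ge0 (_ : _ - _ = S / b.+4%:R * (b.+4%:R * eta ^+ 2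
   - (64 * d%:R ^+ 3 + 2 * d%:R * eta ^+ 2))); last by field; lra.
rewrite mulr_ge0 ?divr_ge0 // subr_ge0; apply: le_trans (ltW xb) _.
by apply: ler_wpM2r; [exact: ltW|rewrite ler_nat; lia].
Qed.

Section Cube.
Local Open Scope complex_scope.
Variables (R : realType) (d : nat) (L : {fset 'rV[int]_d}) (a : 'rV[int]_d) (l b : nat).
Hypothesis L_cube : forall x, (x \in L) = box a l x.

(** The cube contains [q ^ d] disjoint blocks of side [b.+4]; the sites left over near its upper
    faces belong to no block. *)
Let q := (l %/ b.+4)%N.
Let p := #|{ffun 'I_d -> 'I_q}|.

Definition corner (j : 'I_p) : 'rV[int]_d := \row_k (a 0 k + (enum_val j k * b.+4)%N%:Z).

Definition block (j : 'I_p) : {set 'I_#|{: L}|} := [set i | box (corner j) b.+4 (site i)]%SET.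

Lemma block_sub j x : box (corner j) b.+4 x -> x \in L.
Proof.
move=> /boxP H; rewrite L_cube; apply/boxP => k; have := H k; rewrite mxE.
set y := enum_val j k; have yq : (y.+1 * b.+4 <= l)%N.
  by apply: leq_trans (leq_divM l b.+4); rewrite leq_mul2r ltn_ord orbT.
by move: yq; rewrite mulSn; lia.
Qed.

Lemma card_block j : #|block j| = (b.+4 ^ d)%N.
Proof. exact: card_box (@block_sub j). Qed.

Lemma block_disjoint i j x : x \in block i -> x \in block j -> i = j.
Proof.
rewrite !inE => /boxP Hi /boxP Hj; apply: enum_val_inj; apply/ffunP => k.
apply: val_inj => /=; have := Hi k; have := Hj k; rewrite !mxE.
set u := enum_val i k; set v := enum_val j k.
have lt (m n : nat) (y : int) : a 0 k + (m * b.+4)%N%:Z <= y < a 0 k + (m * b.+4)%N%:Z + b.+4%:Z ->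
    a 0 k + (n * b.+4)%N%:Z <= y < a 0 k + (n * b.+4)%N%:Z + b.+4%:Z -> (m <= n)%N.
  move=> /andP[m1 _] /andP[_ n2]; rewrite -ltnS -(ltn_pmul2r (ltn0Sn b.+3)) mulSn.
  by have := le_lt_trans m1 n2; rewrite -addrA ltrD2l -PoszD ltz_nat addnC.
by move=> H1 H2; apply/eqP; rewrite eqn_leq (lt _ _ _ H1 H2) (lt _ _ _ H2 H1).
Qed.

(** As [q] is positive, [l < q.+1 * b.+4] is at most [2 * q * b.+4]: the blocks fill a fixed
    proportion of the volume. *)
Lemma block_card : (b.+4 <= l)%N -> (#|` L| <= p * (2 * b.+4) ^ d)%N.
Proof.
move=> bl; have -> : #|` L| = (l ^ d)%N.
  rewrite cardfE -(@card_box d L a l) => [|x]; last by rewrite L_cube.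
  rewrite -[LHS]card_ord -cardsT; apply: eq_card => i; rewrite !inE.
  by have := site_in i; rewrite L_cube => ->.
have homo_exp e (m n : nat) : (m <= n)%N -> (m ^ e <= n ^ e)%N.
  by case: e => // e mn; rewrite leq_exp2r.
rewrite /p card_ffun !card_ord -expnMn homo_exp //.
have q1 : (0 < q)%N by rewrite divn_gt0.
have lq : (l < q.+1 * b.+4)%N by rewrite ltn_ceil.
apply: leq_trans (ltnW lq) _; rewrite mulnA leq_mul2r; apply/orP; right.
by rewrite muln2 -addnn -addn1 leq_add2l.
Qed.

Lemma block_gain_ge (z : R[i]) (E e delta : R) (j : 'I_p) v w :
    `|z| = 1 -> wave_energy d z = (E - e)%:C -> 0 < delta ->
    16 * d%:R ^+ 2 * ((b.+4 ^ d)%:R - (b ^ d)%:R) <= (delta / 10) ^+ 2 * (b.+2 ^ d)%:R :> R ->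
    (forall x, x \notin block j -> w x = v x) ->
    (forall x, x \in block j -> e + delta / 2 <= v x) ->
    (forall x, x \in block j -> w x <= e - delta / 2) ->
  site_count E v + 1 <= site_count E w.
Proof.
move=> z1 zE delta0 side wv vB wB.
rewrite /site_count natr1 ler_nat.
have bL := @block_sub j; have subE : (E%:C - e%:C = wave_energy d z)%R by rewrite zE rmorphB.
(* With [alpha = delta / 2], the choice [eta = delta / 10] is the largest with [5 * eta <= alpha].
   The test vector is the plane wave of energy [E - e]. *)
apply: (@eig_le_cross _ _ _ _ (block j) (wave_row L (corner j) b z) _ _ e%:C
  (delta / 10)%:C (delta / 2)%:C); rewrite ?real_row ?real_cplx ?subE //.
- exact: dirichlet_laplacian_herm.
- by rewrite ltcR divr_gt0.
- have -> : 5 * (delta / 10)%:C = (5 * (delta / 10))%:C by rewrite [RHS]rmorphM rmorph_nat.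
  by rewrite lecR; lra.
- apply/eqP => phi0; have := sum_wave_row_norm bL z1; rewrite phi0 big1 => [|i _].
    by move/esym/eqP; rewrite pnatr_eq0 expn_eq0.
  by rewrite mxE normr0 expr0n.
- by move=> i; rewrite inE => iB; exact: wave_row_out iB.
- by move=> i; rewrite inE => iB; apply: (wave_residual_out bL z1 iB).
- rewrite (sum_wave_row_norm bL z1); apply: le_trans (sum_wave_residual bL z1) _.
  by move: side; rewrite -lecR !(rmorphM, rmorphB, rmorphXn, rmorph_nat).
- by move=> i iB; rewrite !mxE wv.
- by move=> i iB; rewrite !mxE -rmorphD /= lecR vB.
- by move=> i iB; rewrite !mxE -rmorphB /= lecR wB.
Qed.

Lemma cube_estimate (d0 : measure_display) (T : measurableType d0) (P : probability T R)
    (omega : 'rV[int]_d -> {RV P >-> R}) (E e delta h r : R) :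
    mutually_independent omega -> (0 < d)%N ->
    16 * d%:R ^+ 2 * ((b.+4 ^ d)%:R - (b ^ d)%:R) <= (delta / 10) ^+ 2 * (b.+2 ^ d)%:R :> R ->
    `|E - e| <= 2 * d%:R ->
    (forall x (u : R), e - delta <= u -> u + h <= e + delta ->
       r * h <= fine (P (omega x @^-1` `[u, u + h[%classic))) ->
    0 < h -> h <= delta / 8 -> 0 < r -> r * (delta / 4) <= 1 ->
  exists2 Z : T -> R, measurable_fun setT Z /\
    (forall t, 0 <= Z t <= spectral_trace L (omega ^~ t) (E + 2 * h)
                           - spectral_trace L (omega ^~ t) E) &
    ((p%:R * (r * h * (r * (delta / 4)) ^+ (b.+4 ^ d) / 2))%:E <= \int[P]_t (Z t)%:E)%E.
Proof.
move=> indep d_gt0 side Ee q_ge h0 hd r0 k1.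
have dR : 0 < d%:R :> R by rewrite ltr0n.
have [z z1 zE] : exists2 z : R[i], `|z| = 1 & z + z^-1 = ((E - e) / d%:R)%:C.
  by apply: exists_unit_complex; rewrite normrM normfV normr_nat ler_pdivrMr.
have wE : wave_energy d z = (E - e)%:C.
  by rewrite /wave_energy zE -(rmorph_nat (real_complex R)) -rmorphM /= mulrC divfK ?gt_eqF.
have delta0 : 0 < delta by lra.
have [|||||||||Z [mZ Z_le] intZ] := @finite_volume_estimate _ _ _ P _ 
  (fun i => omega (site i)) (@site_count R d L) p (b.+4 ^ d) block E e delta h r
  (@site_count_anti R d L) block_disjoint.
- by move=> j; apply/set0Pn; rewrite -card_gt0 card_block expn_gt0.
- by move=> j; rewrite card_block.
- by move=> j v w; apply: block_gain_ge z1 wE delta0 side.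
- by move=> K; exact: indep_cell_event.
- by move=> i; exact: q_ge.
- exact: h0.
- exact: hd.
- exact: r0.
- exact: k1.
exists Z => //; split => // t.
by rewrite !spectral_traceE.
Qed.

End Cube.

(** * The density of states *)

(** Once a cube contains both the origin and the point with all coordinates [m], its side exceeds
    [m]. *)
Lemma expanding_cubes_side (d : nat) (L : nat -> {fset 'rV[int]_d}) (m : nat) :
    (0 < d)%N -> expanding_cubes L ->
  exists K : nat, forall k, (K <= k)%N ->
    exists a l, (m <= l)%N /\ forall x, (x \in L k) = box a l x.
Proof.
move=> d_gt0 [cubes incr exh].
pose i0 := Ordinal d_gt0.
have [k0 Hk0] := exh 0; have [k1 Hk1] := exh (const_mx m%:Z).
have mono k k' : (k <= k')%N -> {subset L k <= L k'}.
  move=> /subnK <-; elim: (k' - k)%N => // n IH x /IH.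
  by rewrite addSn; move/fsubsetP: (incr (n + k)%N); apply.
exists (maxn k0 k1) => k kK; have [a [l aL]] := cubes k.
exists a, l; split; last exact: aL.
have := mono _ _ (leq_trans (leq_maxl k0 k1) kK) _ Hk0.
have := mono _ _ (leq_trans (leq_maxr k0 k1) kK) _ Hk1.
rewrite !aL => /forallP/(_ i0) + /forallP/(_ i0); rewrite !mxE; lia.
Qed.

(** Right increments suffice, the derivative being also the limit of the right difference
    quotients. *)
Lemma derive_ge (R : realType) (N : R -> R) (E C h0 : R) : 0 < h0 -> derivable N E 1 ->
  (forall h, 0 < h -> h <= h0 -> C * h <= N (E + h) - N E) -> C <= (N^`())%classic E.
Proof.
move=> h0_gt0 dN quot; rewrite derive1E leNgt; apply/negP => lt.
have /cvgr_lt/(_ _ lt) := dN.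
rewrite near_withinE => -[e /= e0 He].
pose h := Num.min (e / 2) h0.
have h_gt0 : 0 < h by rewrite lt_min h0_gt0 andbT divr_gt0.
have he : h < e by rewrite gt_min; apply/orP; left; lra.
have := He h; rewrite /ball /= sub0r normrN gtr0_norm // => /(_ he).
rewrite gt_eqF // => /(_ isT); rewrite ltNge => /negP; apply.
rewrite /GRing.scale /= mulr1 [h + E]addrC mulrC ler_pdivlMr //.
by apply: quot => //; rewrite ge_min lexx orbT.
Qed.

(** Each block contributes a fixed amount to the expectation, and there is at least one block per
    [(2 * b.+4) ^ d] sites, so the bound per site is uniform in large cubes and survives the
    limit. *)
Lemma ids_increment_ge (R : realType) (d : nat) (d_gt0 : (0 < d)%N)
    (d0 : measure_display) (T : measurableType d0) (P : probability T R)
    (omega : 'rV[int]_d -> {RV P >-> R}) (L : nat -> {fset 'rV[int]_d}) (N : R -> R)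
    (E e delta h r : R) (b : nat) :
    mutually_independent omega -> expanding_cubes L ->
    is_integrated_dos omega L N -> continuous N ->
    16 * d%:R ^+ 2 * ((b.+4 ^ d)%:R - (b ^ d)%:R) <= (delta / 10) ^+ 2 * (b.+2 ^ d)%:R :> R ->
    `|E - e| <= 2 * d%:R ->
    (forall x (u : R), e - delta <= u -> u + h <= e + delta ->
       r * h <= fine (P (omega x @^-1` `[u, u + h[%classic))) ->
    0 < h -> h <= delta / 8 -> 0 < r -> r * (delta / 4) <= 1 ->
  r * h * (r * (delta / 4)) ^+ (b.+4 ^ d) / 2 / ((2 * b.+4) ^ d)%:R <= N (E + 2 * h) - N E.
Proof.
move=> indep cubes [N_nd N_lim] N_cont side Ee q_ge h0 hd r0 k1.
have [K KP] := expanding_cubes_side b.+4 d_gt0 cubes.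
pose g := r * h * (r * (delta / 4)) ^+ (b.+4 ^ d) / 2.
have g0 : 0 <= g.
  by rewrite /g divr_ge0 // mulr_ge0 ?exprn_ge0 // mulr_ge0 ?ltW //; lra.
rewrite -/g; pose c := g / ((2 * b.+4) ^ d)%:R.
pose Y k t := (#|` L k|%:R)^-1 * (spectral_trace (L k) (omega ^~ t) (E + 2 * h)
  - spectral_trace (L k) (omega ^~ t) E).
have Y_ge0 k t : 0 <= Y k t.
  rewrite mulr_ge0 ?invr_ge0 // subr_ge0 !spectral_traceE.
  by apply: site_count_anti => x; lra.
have Y_le1 k t : Y k t <= 1.
  (* An early cube may be empty; the convention that [0] is its own inverse then makes [Y]
     vanish. *)
  rewrite /Y; have [->|n0] := eqVneq #|` L k| 0%N; first by rewrite invr0 mul0r.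
  rewrite mulrC ler_pdivrMr ?ltr0n ?lt0n // mul1r !spectral_traceE.
  apply: le_trans (site_count_le (E + 2 * h) (fun i : 'I_#|{: L k}| => omega (site i) t)).
  by rewrite lerBlDr lerDl site_count_ge0.
have exZ k : exists Z : T -> R, [/\ measurable_fun setT Z, forall t, 0 <= Z t <= Y k t
    & (K <= k)%N -> (c%:E <= \int[P]_t (Z t)%:E)%E].
  have [Kk|kK] := leqP K k; last first.
    (* Cubes of index below [K] may be too small to hold a block; only large indices matter. *)
    exists (cst 0); split => [|t|]; [exact: measurable_cst|by rewrite lexx Y_ge0|by []].
  have [a [l [bl aL]]] := KP k Kk.
  have [Z [mZ ZY] intZ] := cube_estimate aL indep d_gt0 side Ee q_ge h0 hd r0 k1.
  have n0 : (0 < #|` L k|)%N.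
    rewrite cardfs_gt0; apply/fset0Pn; exists a; rewrite aL; apply/boxP => i.
    by rewrite lexx ltrDl ltz_nat (leq_trans _ bl).
  have nR : 0 < #|` L k|%:R :> R by rewrite ltr0n.
  exists (fun t => (#|` L k|%:R)^-1 * Z t); split.
  - exact: measurable_funM.
  - move=> t; have /andP[Z0 ZYt] := ZY t.
    by rewrite mulr_ge0 ?invr_ge0 //= /Y ler_wpM2l ?invr_ge0.
  - move=> _; under eq_integral do rewrite EFinM.
    have Z0 t : [set: T] t -> (0 <= (Z t)%:E)%E by rewrite lee_fin; have /andP[] := ZY t.
    rewrite ge0_integralZl ?lee_fin ?invr_ge0 //; last exact/measurable_EFinP.
    apply: (@le_trans _ _ ((#|` L k|%:R^-1)%:E * (#|{ffun 'I_d -> 'I_(l %/ b.+4)}|%:R * g)%:E)%E).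
      rewrite -EFinM lee_fin /c ler_pdivlMl // mulrA ler_pdivrMr ?ltr0n ?expn_gt0 //.
      rewrite mulrAC -natrM ler_wpM2r // ler_nat.
      exact: block_card aL bl.
    by rewrite lee_wpmul2l // lee_fin invr_ge0.
have [Z ZP] := choice exZ.
apply: (@limit_expectation_ge _ _ _ P Y Z _ _ K) => //.
- by move=> k; have [] := ZP k.
- by move=> k t; have [] := ZP k.
- apply: filterS N_lim => t lim_t.
  rewrite /Y; under eq_fun do rewrite mulrBr.
  by apply: cvgB; apply: lim_t; exact: N_cont.
- by rewrite subr_ge0; apply: N_nd; lra.
- by move=> k; have [] := ZP k.
Qed.

Theorem theorem1 (R : realType) (d : nat) (d_gt0 : (0 < d)%N)
  (d0 : measure_display) (T : measurableType d0) (P : probability T R)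
  (omega : 'rV[int]_d -> {RV P >-> R})
  (omega_indep : mutually_independent omega)
  (omega_ident : identically_distributed omega)
  (rho : R -> R) (omega_density : has_density (omega 0) rho)
  (Wm Wp : R) (W_lt : Wm < Wp)
  (rho_min_gt0 : (0 < ess_inf_itv rho Wm Wp)%E)
  (L : nat -> {fset 'rV[int]_d}) (L_cubes : expanding_cubes L)
  (N : R -> R) (N_ids : is_integrated_dos omega L N)
  (N_ac : abs_continuous N) :
  exists2 delta0 : R, 0 < delta0 &
    forall delta : R, 0 < delta -> delta < delta0 ->
      exists2 C : R, 0 < C &
        {ae (@lebesgue_measure R), forall E : R,
          - (2 * d%:R) + Wm + delta <= E <= 2 * d%:R + Wp - delta ->
          derivable N E 1 /\ C <= (N^`())%classic E}.
Proof.
have dR : 0 <= d%:R :> R by [].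
(* This makes the interval of centres from [Wm + delta] to [Wp - delta] nonempty. *)
exists ((Wp - Wm) / 2); first by lra.
move=> delta delta_gt0 delta_lt.
have [r1 r1_gt0 rho_ge] := ess_inf_itv_gt0 rho_min_gt0.
(* The second bound ensures [r * (delta / 4) <= 1], needed to use the block size as a common
   exponent. *)
pose r := Num.min r1 (4 / delta).
have r_gt0 : 0 < r by rewrite lt_min r1_gt0 divr_gt0.
have r_delta : r * (delta / 4) <= 1.
  have : r <= 4 / delta by rewrite ge_min lexx orbT.
  by rewrite ler_pdivlMr // => ?; lra.
have /rho_ge {}rho_ge : r <= r1 by rewrite ge_min lexx.
have [b side] := exists_side d (divr_gt0 delta_gt0 (ltr0n R 10)).
(* The increment bound per unit of energy step [t = 2 * h], whence the factor [4]; it does not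
   depend on [E]. *)
pose g := r * (r * (delta / 4)) ^+ (b.+4 ^ d) / 4 / ((2 * b.+4) ^ d)%:R.
exists g.
  rewrite /g divr_gt0 ?ltr0n ?expn_gt0 // divr_gt0 // mulr_gt0 // exprn_gt0 // mulr_gt0 //; lra.
pose M : R := 2 * d%:R + `|Wm| + `|Wp| + 1.
have := ae_derivable N_ids.1 N_ac M.
apply: filterS; first exact: (ae_filter_ringOfSetsType (@lebesgue_measure R)).
move=> E dE /andP[E1 E2].
have [m1 m2] := (ler_norm Wp, ler_norm (- Wm)); rewrite normrN in m2.
have [m3 m4] := (normr_ge0 Wp, normr_ge0 Wm).
have dNE : derivable N E 1 by apply: dE; rewrite /M; apply/andP; split; lra.
split=> //.
(* [e] is the point nearest to [E] for which the window of half-width [delta] stays in [[Wm, Wp]];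
   the range of [E] puts [E - e] in the spectrum of the Laplacian. *)
have [e e_win Ee] : exists2 e, Wm + delta <= e <= Wp - delta & `|E - e| <= 2 * d%:R.
  have [EW|EW] := leP E (Wm + delta).
    exists (Wm + delta); first by apply/andP; split; lra.
    by rewrite ler_norml; apply/andP; split; lra.
  have [EW'|EW'] := leP (Wp - delta) E.
    exists (Wp - delta); first by apply/andP; split; lra.
    by rewrite ler_norml; apply/andP; split; lra.
  exists E; first by apply/andP; split; lra.
  by rewrite subrr normr0 mulr_ge0.
have /andP[e1 e2] := e_win.
apply: (@derive_ge _ _ _ _ (delta / 4)) => //; first by lra.
move=> t t0 td; pose h := t / 2.
have tE : t = 2 * h by rewrite /h; lra.
have h0 : 0 < h by rewrite /h; lra.
have gE : g * t = r * h * (r * (delta / 4)) ^+ (b.+4 ^ d) / 2 / ((2 * b.+4) ^ d)%:R.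
  by rewrite /g tE; field; rewrite pnatr_eq0 expn_eq0.
rewrite gE tE.
apply: (ids_increment_ge d_gt0 omega_indep L_cubes N_ids _ side Ee) => //.
- exact: abs_continuous_continuous N_ac.
- move=> x u u1 u2.
  have -> : P (omega x @^-1` `[u, u + h[%classic) = P (omega 0 @^-1` `[u, u + h[%classic).
    by apply: (omega_ident x 0); exact: measurable_itv.
  apply: (density_prob_ge omega_density _ rho_ge); lra.
- by rewrite /h; lra.
Qed.
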